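(* Let $E\in(-2,2)$, write $E=2\cos k$ with $k\in(0,\pi)$, and set $z=e^{-ik}$. For all $r,s\in\mathbb{Z}$ the boundary values $[R_H(E\pm i0)]_{s,r}:=\lim_{\epsilon\to0^+}[R_H(E\pm i\epsilon)]_{s,r}$ of the matrix elements of the resolvent exist and are given by $$[R_{H}(E \pm i0)]_{s,r} = -i\,u_{+}^{z^{\pm 1}}(s)\left(W(u_{-}^{z^{\pm 1}}, u_{+}^{z^{\pm 1}})\right)^{-1} u_{-}^{z^{\pm 1}}(r)^{*}, \qquad s \geq r,$$ $$[R_{H}(E \pm i0)]_{s,r} = i\,u_{-}^{z^{\mp 1}}(s)\left(W(u_+^{z^{\mp 1}}, u_-^{z^{\mp 1}})\right)^{-1} u_{+}^{z^{\mp 1}}(r)^{*},\qquad s<r,$$ where a matrix on the right-hand side is identified with the operator of left multiplication by it on $\mathcal{M}_L$.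
   Context: Fix $L\ge 1$. $\mathcal{M}_L$ is the space of complex $L\times L$ matrices with inner product $\langle A,B\rangle=\operatorname{tr}(B^*A)$. $V=(V(n))_{n\in\mathbb{Z}}$ is a sequence of self-adjoint matrices in $\mathcal{M}_L$ with $\|V\|_0:=\sum_{n}\|V(n)\|<\infty$. For $u\in\mathcal{M}_L^{\mathbb{Z}}$ put $(\tau u)(n)=u(n+1)+u(n-1)+V(n)u(n)$, and let $H$ be the restriction of $\tau$ to $\ell^2(\mathbb{Z},\mathcal{M}_L)$; $H$ is bounded and self-adjoint. $R_H(E)=(H-E)^{-1}$ for $E\notin\sigma(H)$. Jost solutions: for $0<|\zeta|\le 1$, $\zeta\ne\pm1$, $u_+^{\zeta}\in\mathcal{M}_L^{\mathbb{Z}}$ is the solution of $\tau u=(\zeta+1/\zeta)u$ with $u_+^\zeta(n)=\zeta^n(I+o(1))$ as $n\to+\infty$; for $|\zeta|\ge1$, $\zeta\neq\pm1$, $u_-^{\zeta}$ is the solution of $\tau u=(\zeta+1/\zeta)u$ with $u_-^\zeta(n)=\zeta^n(I+o(1))$ as $n\to-\infty$. Wronskian: $W(u,v)(n)=i\big(u(n+1)^*v(n)-u(n)^*v(n+1)\big)$. When one of $u,v$ solves $\tau u=Eu$ and the other solves $\tau v=\overline{E}v$, it does not depend on $n$ and is written $W(u,v)\in\mathcal{M}_L$. Kernel: for a bounded operator $\mathcal{K}$ on $\ell^2(\mathbb{Z},\mathcal{M}_L)$, $[\mathcal{K}]_{s,r}=\pi_s\mathcal{K}\pi_r^*\in B(\mathcal{M}_L)$,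 where $\pi_s(u)=u(s)$ and $(\pi_r^*A)(n)=\delta_{n,r}A$. *)

(* Defs.v *)
From HB Require Import structures.
From mathcomp Require Import all_boot all_order all_algebra.
From mathcomp Require Import complex.
From mathcomp Require Import all_classical all_reals all_analysis.
From mathcomp Require Import ring lra.

Set Implicit Arguments.
Unset Strict Implicit.
Unset Printing Implicit Defensive.

Import Order.TTheory GRing.Theory Num.Theory.
Import numFieldNormedType.Exports.

Local Open Scope ring_scope.
Local Open Scope classical_set_scope.
Local Open Scope sesquilinear_scope.
Local Open Scope complex_scope.

Section HilbertSchmidt.
Context {R : realType} {L : nat}.
Implicit Types A B : 'M[R[i]]_L.

Definition hsdot A B : R[i] := \tr (B^t* *m A).

Definition hsnorm A : R := Num.sqrt (complex.Re (hsdot A A)).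

Lemma hsdotE A :
  complex.Re (hsdot A A) =
  \sum_i \sum_j (complex.Re (A i j) ^+ 2 + complex.Im (A i j) ^+ 2).
Proof.
have ReD : {morph @complex.Re R : x y / x + y} by move=> [? ?] [? ?].
rewrite /hsdot /mxtrace (big_morph _ ReD (erefl : complex.Re 0 = 0)).
rewrite exchange_big/=; apply: eq_bigr => j _.
rewrite mxE (big_morph _ ReD (erefl : complex.Re 0 = 0)); apply: eq_bigr => i _.
by rewrite !mxE; case: (A i j) => a b /=; ring.
Qed.

Lemma hsnorm_ge0 A : 0 <= hsnorm A.
Proof. exact: sqrtr_ge0. Qed.

Lemma hsnorm_sqr A :
  hsnorm A ^+ 2 =
  \sum_i \sum_j (complex.Re (A i j) ^+ 2 + complex.Im (A i j) ^+ 2).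
Proof.
rewrite sqr_sqrtr hsdotE//; do 2 apply: sumr_ge0 => ? _.
by rewrite addr_ge0 ?sqr_ge0.
Qed.

Lemma hsnorm_sqrD A B :
  hsnorm (A + B) ^+ 2 <= 2 * hsnorm A ^+ 2 + 2 * hsnorm B ^+ 2.
Proof.
rewrite !hsnorm_sqr !mulr_sumr -big_split/=; apply: ler_sum => i _.
rewrite !mulr_sumr -big_split/=; apply: ler_sum => j _.
rewrite !mxE; case: (A i j) (B i j) => [a b] [c d]/=.
have := sqr_ge0 (a - c); have := sqr_ge0 (b - d); nra.
Qed.

Lemma hsnorm_sqrZ (a : R[i]) A :
  hsnorm (a *: A) ^+ 2 =
  (complex.Re a ^+ 2 + complex.Im a ^+ 2) * hsnorm A ^+ 2.
Proof.
rewrite !hsnorm_sqr !mulr_sumr; apply: eq_bigr => i _.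
rewrite !mulr_sumr; apply: eq_bigr => j _.
by rewrite !mxE; case: a (A i j) => [a b] [c d]/=; ring.
Qed.

Lemma hsnorm0 : hsnorm 0 = 0.
Proof. by rewrite /hsnorm /hsdot mulmx0 mxtrace0/= sqrtr0. Qed.

Lemma sqr_sumr_le (n : nat) (x : 'I_n -> R) :
  (\sum_k x k) ^+ 2 <= n%:R * \sum_k x k ^+ 2.
Proof.
elim: n x => [|n IHn] x; first by rewrite !big_ord0 expr0n mulr0.
rewrite !big_ord_recl; set S := \sum_(i < n) _; set Q := \sum_(i < n) _.
have SQ : S ^+ 2 <= n%:R * Q by exact: IHn.
have Q0 : 0 <= Q by apply: sumr_ge0 => i _; exact: sqr_ge0.
case: n => [|n] in x S Q SQ Q0 IHn *.
  by rewrite /S big_ord0 addr0 mul1r lerDl.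
set m : R := n.+1%:R in SQ *.
have m0 : 0 < m by rewrite ltr0Sn.
rewrite -(@natr1 _ n.+1) -/m.
rewrite -subr_ge0 -(pmulr_rge0 _ m0).
have -> : m * ((m + 1) * (x ord0 ^+ 2 + Q) - (x ord0 + S) ^+ 2) =
    (m * x ord0 - S) ^+ 2 + (m + 1) * (m * Q - S ^+ 2) by ring.
apply: addr_ge0; first exact: sqr_ge0.
by apply: mulr_ge0; [rewrite addr_ge0// ltW|rewrite subr_ge0].
Qed.

Lemma hsnorm_sqrM A B :
  hsnorm (A *m B) ^+ 2 <= (2 * L%:R) * hsnorm A ^+ 2 * hsnorm B ^+ 2.
Proof.
have ReD : {morph @complex.Re R : x y / x + y} by move=> [? ?] [? ?].
have ImD : {morph @complex.Im R : x y / x + y} by move=> [? ?] [? ?].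
pose q (x : R[i]) := complex.Re x ^+ 2 + complex.Im x ^+ 2.
rewrite !hsnorm_sqr.
apply: (@le_trans _ _ (\sum_i \sum_j (2 * L%:R) *
    \sum_k (q (A i k) * q (B k j)))).
  apply: ler_sum => i _; apply: ler_sum => j _; rewrite mxE.
  rewrite (big_morph _ ReD (erefl : complex.Re 0 = 0)).
  rewrite (big_morph _ ImD (erefl : complex.Im 0 = 0)).
  apply: (le_trans (lerD (sqr_sumr_le _) (sqr_sumr_le _))).
  rewrite -mulrDr -big_split/= (mulrC 2) -mulrA ler_wpM2l// mulr_sumr.
  apply: ler_sum => k _; rewrite /q; case: (A i k) (B k j) => [a b] [c d]/=.
  have : 0 <= (a * c - b * d) ^+ 2 + (a * d + b * c) ^+ 2.
    by rewrite addr_ge0 ?sqr_ge0.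
  nra.
have -> : (\sum_i \sum_j 2 * L%:R * \sum_k q (A i k) * q (B k j) : R) =
    2 * L%:R * \sum_i \sum_k q (A i k) * \sum_j q (B k j).
  rewrite mulr_sumr; apply: eq_bigr => i _; rewrite -mulr_sumr exchange_big/=.
  by congr (_ * _); apply: eq_bigr => k _; rewrite mulr_sumr.
rewrite -[leRHS]mulrA ler_wpM2l ?mulr_ge0// mulr_suml; apply: ler_sum => i _.
rewrite mulr_suml; apply: ler_sum => k _.
have q0 x : 0 <= q x by rewrite addr_ge0 ?sqr_ge0.
apply: ler_wpM2l; first exact: q0.
rewrite [leRHS](bigD1 k)//= lerDl; apply: sumr_ge0 => l _; apply: sumr_ge0 => j _.
exact: q0.
Qed.

End HilbertSchmidt.

Section SquareSummable.
Context {R : realType} {L : nat}.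
Local Notation M := 'M[R[i]]_L.

Definition l2_pred : {pred int -> M} :=
  mem [set u : int -> M | summable setT (fun n => (hsnorm (u n) ^+ 2)%:E)].

Lemma summable_nnegP (f : int -> R) : (forall n, 0 <= f n) ->
  summable setT (EFin \o f) = (\esum_(n in setT) (f n)%:E < +oo)%E.
Proof.
move=> f0; rewrite /summable; congr (_ < _)%E; apply: eq_esum => n _.
by rewrite gee0_abs// lee_fin.
Qed.

Lemma l2_predE (u : int -> M) :
  (u \in l2_pred) = (\esum_(n in setT) (hsnorm (u n) ^+ 2)%:E < +oo)%E.
Proof.
rewrite -summable_nnegP => [|n]; last exact: sqr_ge0.
by apply/idP/idP; rewrite inE.
Qed.

Lemma esum_nat_mul (N : nat) (f : int -> R) : (forall n, 0 <= f n) ->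
  (\esum_(n in setT) (f n)%:E < +oo)%E ->
  (\esum_(n in setT) (N%:R * f n)%:E < +oo)%E.
Proof.
move=> f0 ffin; elim: N => [|N IHN].
  by rewrite esum1 ?ltry// => n _; rewrite mul0r.
rewrite (eq_esum (b := fun n => ((N%:R * f n)%:E + (f n)%:E)%E)); last first.
  by move=> n _; rewrite -EFinD -natr1 mulrDl mul1r.
by rewrite esumD ?lte_add_pinfty// => n _; rewrite lee_fin ?mulr_ge0.
Qed.

Lemma l2_le (c : R) (u v : int -> M) :
  (forall n, hsnorm (u n) ^+ 2 <= c * hsnorm (v n) ^+ 2) ->
  v \in l2_pred -> u \in l2_pred.
Proof.
rewrite !l2_predE => uv vl2; pose N := (Num.truncn `|c|).+1.
apply: le_lt_trans (esum_nat_mul N (fun n => sqr_ge0 _) vl2).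
apply: le_esum => n _; rewrite lee_fin (le_trans (uv n))// ler_wpM2r ?sqr_ge0//.
by rewrite (le_trans (ler_norm c))// ltW// truncnS_gt.
Qed.

Lemma l2_0 : (0 : int -> M) \in l2_pred.
Proof. by rewrite l2_predE esum1 ?ltry// => n _; rewrite hsnorm0 expr0n. Qed.

Lemma l2D (u v : int -> M) :
  u \in l2_pred -> v \in l2_pred -> u + v \in l2_pred.
Proof.
rewrite !l2_predE => ul2 vl2.
have sq0 (w : int -> M) n : 0 <= hsnorm (w n) ^+ 2 by exact: sqr_ge0.
have := lte_add_pinfty (esum_nat_mul 2 (sq0 u) ul2) (esum_nat_mul 2 (sq0 v) vl2).
rewrite -esumD; try by move=> n _; rewrite lee_fin mulr_ge0.
by apply: le_lt_trans; apply: le_esum => n _; rewrite lee_fin hsnorm_sqrD.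
Qed.

Lemma l2Z (a : R[i]) (u : int -> M) : u \in l2_pred -> a *: u \in l2_pred.
Proof. by apply: l2_le => n; rewrite hsnorm_sqrZ. Qed.

Lemma l2_submod_closed : submod_closed l2_pred.
Proof. by split=> [|a u v ul2 vl2]; [exact: l2_0|rewrite l2D ?l2Z]. Qed.

HB.instance Definition _ := GRing.isSubmodClosed.Build R[i] (int -> M) l2_pred
  l2_submod_closed.

Lemma l2_shift (k : int) (u : int -> M) :
  u \in l2_pred -> (fun n => u (n + k)) \in l2_pred.
Proof.
have shift_bij : set_bij setT setT (fun n : int => n + k).
  split=> // [n m _ _|m _]; first exact: addIr.
  by exists (m - k); rewrite ?subrK.
rewrite !l2_predE; apply: le_lt_trans.
by rewrite [leRHS](reindex_esum _ _ _ (fun n => (hsnorm (u n) ^+ 2)%:E) shift_bij).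
Qed.

Lemma l2_delta (r : int) (A : M) :
  (fun n => if n == r then A else 0) \in l2_pred.
Proof.
rewrite l2_predE; have := ltry (hsnorm A ^+ 2).
rewrite -(@esum_set1 R int r (fun=> (hsnorm A ^+ 2)%:E)) ?lee_fin ?sqr_ge0//.
rewrite esum_mkcond; apply: le_lt_trans; apply: le_esum => n _.
by rewrite in_set1; case: eqP => // _; rewrite hsnorm0 expr0n.
Qed.

End SquareSummable.

Section Ell2.
Variables (R : realType) (L : nat).
Local Notation M := 'M[R[i]]_L.

Record ell2 := Ell2 { ell2_val :> int -> M ; _ : ell2_val \in l2_pred }.

HB.instance Definition _ := [isSub for ell2_val].
HB.instance Definition _ := [Choice of ell2 by <:].
HB.instance Definition _ := [SubChoice_isSubLmodule of ell2 by <:].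

Definition ell2_norm (u : ell2) : R :=
  Num.sqrt (fine (\esum_(n in setT) (hsnorm (u n) ^+ 2)%:E)).

Definition bounded_operator (K : ell2 -> ell2) : Prop :=
  linear K /\ exists c : R, forall u, ell2_norm (K u) <= c * ell2_norm u.

Definition ell2_proj (s : int) (u : ell2) : M := u s.

Definition ell2_proj_adj (r : int) (A : M) : ell2 := Ell2 (l2_delta r A).

(* The matrix element [K]_{s,r}, an operator on matrices. *)
Definition matrix_element (K : ell2 -> ell2) (s r : int) (A : M) : M :=
  ell2_proj s (K (ell2_proj_adj r A)).

End Ell2.

Section Schroedinger.
Context {R : realType} {L : nat}.
Local Notation M := 'M[R[i]]_L.
Implicit Types (V u v : int -> M).

Definition self_adjoint V : Prop := forall n, (V n)^t* = V n.

Definition summable_potential V : Prop :=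
  summable setT (fun n => (hsnorm (V n))%:E).

Definition tau V u (n : int) : M := u (n + 1) + u (n - 1) + V n *m u n.

Lemma summable_potential_bounded V : summable_potential V ->
  exists c : R, forall n, hsnorm (V n) ^+ 2 <= c.
Proof.
rewrite /summable_potential summable_nnegP => [Vfin|n]; last exact: hsnorm_ge0.
set S := (X in (X < _)%E) in Vfin.
have Vn n : ((hsnorm (V n))%:E <= S)%E.
  rewrite -(@esum_set1 R int n (fun m => (hsnorm (V m))%:E)) ?lee_fin ?hsnorm_ge0//.
  rewrite esum_mkcond; apply: le_esum => m _.
  by case: ifP => // _; rewrite lee_fin hsnorm_ge0.
have S0 : (0 <= S)%E.
  by apply: (le_trans _ (Vn 0)); rewrite lee_fin hsnorm_ge0.
have Sfin : S \is a fin_num by rewrite ge0_fin_numE.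
exists (fine S ^+ 2) => n; rewrite lerXn2r ?nnegrE ?hsnorm_ge0 ?fine_ge0//.
by rewrite -lee_fin fineK.
Qed.

Lemma tau_l2 V : summable_potential V ->
  forall u, u \in l2_pred -> tau V u \in l2_pred.
Proof.
move=> /summable_potential_bounded[c Vc] u ul2.
have -> : tau V u =
  (fun n => u (n + 1)) + (fun n => u (n - 1)) + (fun n => V n *m u n) by [].
rewrite !l2D ?l2_shift//.
apply: (@l2_le _ _ (2 * L%:R * c) _ u) => // n.
rewrite (le_trans (hsnorm_sqrM _ _))// ler_wpM2r ?sqr_ge0//.
by rewrite ler_wpM2l// mulr_ge0.
Qed.

Definition schrodinger V (Vsum : summable_potential V) (u : ell2 R L) : ell2 R L :=
  Ell2 (tau_l2 Vsum (valP u)).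

Definition is_resolvent V (Vsum : summable_potential V) (E : R[i])
    (K : ell2 R L -> ell2 R L) : Prop :=
  [/\ bounded_operator K,
      forall u : ell2 R L, schrodinger Vsum (K u) - E *: K u = u &
      forall u : ell2 R L, K (schrodinger Vsum u - E *: u) = u].

(* The inverse of schrodinger Vsum - E when E is not in the spectrum (it is then
   unique); the zero map when E is in the spectrum. *)
Definition resolvent V (Vsum : summable_potential V) (E : R[i]) :
    ell2 R L -> ell2 R L :=
  xget (fun=> 0) [set K | is_resolvent Vsum E K].

(* Convergence of T eps, as eps decreases to 0, for the operator norm of B(M_L). *)
Definition op_cvg (T : R -> M -> M) (T0 : M -> M) : Prop :=
  forall e : R, 0 < e ->
    \forall eps \near 0^'+, forall A, hsnorm (T eps A - T0 A) <= e * hsnorm A.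

(* u n = zeta ^ n (I + o(1)) at +oo is read as zeta ^ (- n) u n --> I. *)
Definition is_jost_plus V (zeta : R[i]) u : Prop :=
  tau V u = (zeta + zeta^-1) *: u /\
  hsnorm ((zeta ^ (- n%:Z)) *: u n%:Z - 1%:M) @[n --> \oo] --> (0 : R).

Definition is_jost_minus V (zeta : R[i]) u : Prop :=
  tau V u = (zeta + zeta^-1) *: u /\
  hsnorm ((zeta ^ n%:Z) *: u (- n%:Z) - 1%:M) @[n --> \oo] --> (0 : R).

(* On the domains used here (0 < |zeta| <= 1, resp. |zeta| >= 1, and zeta <> 1, -1)
   the solution is unique, so xget picks it. *)
Definition jost_plus V (zeta : R[i]) : int -> M :=
  xget 0 [set u | is_jost_plus V zeta u].

Definition jost_minus V (zeta : R[i]) : int -> M :=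
  xget 0 [set u | is_jost_minus V zeta u].

Definition wronskian_at u v (n : int) : M :=
  'i%C *: ((u (n + 1))^t* *m v n - (u n)^t* *m v (n + 1)).

(* By wronskian_const the base point 0 is immaterial whenever V is self-adjoint,
   tau V u = E u and tau V v = E^* v. *)
Definition wronskian u v : M := wronskian_at u v 0.

Lemma wronskian_const V (E : R[i]) u v : self_adjoint V ->
  tau V u = E *: u -> tau V v = E^* *: v ->
  forall n, wronskian_at u v n = wronskian u v.
Proof.
move=> Vsa tu tv n.
have step m : wronskian_at u v (m + 1) = wronskian_at u v m.
  have uE : u (m + 1 + 1) = E *: u (m + 1) - u m - V (m + 1) *m u (m + 1).
    rewrite -[E *: u (m + 1)]/((E *: u) (m + 1)) -tu /tau addrK.
    by rewrite [RHS]addrAC addrK addrK.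
  have vE : v (m + 1 + 1) = E^* *: v (m + 1) - v m - V (m + 1) *m v (m + 1).
    rewrite -[E^* *: v (m + 1)]/((E^* *: v) (m + 1)) -tv /tau addrK.
    by rewrite [RHS]addrAC addrK addrK.
  rewrite /wronskian_at uE vE; congr (_ *: _).
  have -> : (E *: u (m + 1) - u m - V (m + 1) *m u (m + 1))^t* =
      E^* *: (u (m + 1))^t* - (u m)^t* - (u (m + 1))^t* *m V (m + 1).
    by rewrite !linearB linearZ/= !map_mxB map_mxZ trmx_mul map_mxM Vsa.
  rewrite !mulmxBl !mulmxBr -scalemxAl -scalemxAr -mulmxA.
  have aux (a b c d : M) : a - b - c - (a - d - c) = d - b.
    by rewrite !opprB addrA subrK addrC addrA subrK.
  exact: aux.
elim/int_rec: n => [|n IHn|n IHn].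
- by [].
- by rewrite -addn1 PoszD step.
- by rewrite -step -addn1 PoszD opprD subrK.
Qed.

Definition expi (t : R) : R[i] := cos t +i* sin t.

End Schroedinger.

(* Main.v *)
(** For [0 < |zeta| < 1] and [w = zeta + 1/zeta], the solutions of [tau u = w u] that
    decay at [+oo] and at [-oo] give the Green function: by the duality of solution bases
    under the Wronskian form, the kernel of the theorem (with [z] replaced by [zeta] in [u_+]
    and by [1 / conj zeta], its equal on the circle, in the factor [u_-^*]) is continuous
    across the diagonal with the right jump, so each of its columns is square summable and
    is mapped to a delta by [H - w].  As the resolvent at [w] is a left
    inverse of [H - w], the kernel is its matrix element.

    The resolvent exists at nonreal [w] because
      [|u - i t (H - w) u|^2 = (1 - 2 t Im w) |u|^2 + t^2 |(H - w) u|^2],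
    which makes [1 - i t (H - w)] a contraction for small [t] (Neumann series) and, with
    [t = 1 / Im w], gives [|Im w| |u| <= |(H - w) u|].

    The Jost solutions are limits, uniform in [zeta], of those of the truncated potentials,
    hence are continuous in [zeta] up to the unit circle.  On the circle
    [alpha = W(u_-^z, u_+^z)] is invertible: expanding [u_+^z] in [u_-^z] and
    [u_-^(1/z)] gives [alpha^* alpha = c^2 + beta^* beta] with [c = 2 Im z <> 0].  It remains
    to let [zeta], the root of [zeta + 1/zeta = E +- i eps] in the unit disk, tend to
    [z^(+-1)]. *)

Require Import Defs.
From HB Require Import structures.
From mathcomp Require Import all_boot all_order all_algebra.
From mathcomp Require Import finmap complex.
From mathcomp Require Import all_classical all_reals all_analysis.
From mathcomp Require Import ring lra zify.

Import Order.TTheory GRing.Theory Num.Theory.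
Import numFieldNormedType.Exports.

Local Open Scope ring_scope.
Local Open Scope classical_set_scope.
Local Open Scope sesquilinear_scope.
Local Open Scope complex_scope.

Set Implicit Arguments.
Unset Strict Implicit.
Unset Printing Implicit Defensive.

(** The Wronskian pairs an energy with its conjugate, so the kernel at a nonreal energy needs four
    solutions: those decaying at either end for [w], and those for the conjugate of [w]. On the
    circle the two energies agree and [conj z = 1/z], and the four become the Jost solutions at [z]
    and [1/z]. Those normalized at [-oo] are obtained as reflections of solutions normalized at
    [+oo] for the reflected potential, with inverted parameter.

    On the circle the solutions oscillate, so nothing can be read off from decay: invertibility and
    uniqueness both rest on the self-Wronskian [2 Im z] being nonzero. Invertibility is proved only
    there; as an open condition, it carries over by continuity to the energies close to the
    boundary, which is all that the limit uses. Uniqueness, also proved only there, identifies the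
    constructed solutions with those picked by [xget]; off the circle the kernel is written with the
    constructed ones. *)

Local Notation normc := Normc.normc.

(** * Matrix norm and convergence *)

Lemma normcB {R : rcfType} (x y : R[i]) : normc (x - y) = normc (y - x).
Proof. by rewrite -opprB normcN. Qed.

Lemma normc_conj {R : rcfType} (x : R[i]) : normc x^* = normc x.
Proof. by case: x => a b /=; rewrite sqrrN. Qed.

Lemma normcX {R : rcfType} (x : R[i]) n : normc (x ^+ n) = normc x ^+ n.
Proof.
by elim: n => [|n IHn]; rewrite ?expr0 ?Normc.normc1// !exprS Normc.normcM IHn.
Qed.

Lemma normcXz {R : rcfType} (x : R[i]) (n : int) : normc (x ^ n)%R = (normc x ^ n)%R.
Proof.
by case: n => n; rewrite ?NegzE -?exprnP ?exprnN ?Normc.normcV ?normcX.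
Qed.

Lemma normc_ge0 {R : rcfType} (x : R[i]) : 0 <= normc x.
Proof. by case: x => a b; exact: sqrtr_ge0. Qed.

Lemma normc_gt0 {R : rcfType} (x : R[i]) : (0 < normc x) = (x != 0).
Proof.
rewrite lt_neqAle normc_ge0 andbT eq_sym; apply/idP/idP; apply: contra_neq.
  by move=> ->; exact: Normc.normc0.
exact: Normc.eq0_normc.
Qed.

Lemma sqr_normcE {R : rcfType} (x : R[i]) :
  normc x ^+ 2 = complex.Re x ^+ 2 + complex.Im x ^+ 2.
Proof. by case: x => a b /=; rewrite sqr_sqrtr// addr_ge0 ?sqr_ge0. Qed.

Lemma normc_Re_le {R : rcfType} (x : R[i]) : `|complex.Re x| <= normc x.
Proof.
by rewrite -ler_sqr ?nnegrE ?normc_ge0// sqr_normcE real_normK ?num_real// lerDl sqr_ge0.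
Qed.

Lemma normc_Im_le {R : rcfType} (x : R[i]) : `|complex.Im x| <= normc x.
Proof.
by rewrite -ler_sqr ?nnegrE ?normc_ge0// sqr_normcE real_normK ?num_real// lerDr sqr_ge0.
Qed.

Lemma normc_le_ReIm {R : rcfType} (x : R[i]) :
  normc x <= `|complex.Re x| + `|complex.Im x|.
Proof.
rewrite -ler_sqr ?nnegrE ?normc_ge0 ?addr_ge0// sqr_normcE sqrrD.
by rewrite !real_normK ?num_real// -addrA lerD2l lerDr mulrn_wge0// mulr_ge0.
Qed.

Lemma normc_sum_le {R : rcfType} (I : Type) (s : seq I) (P : pred I) (F : I -> R[i]) :
  normc (\sum_(i <- s | P i) F i) <= \sum_(i <- s | P i) normc (F i).
Proof.
elim/big_ind2: _ => //; first by rewrite Normc.normc0.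
by move=> x1 x2 y1 y2 h1 h2; rewrite (le_trans (le_normcD _ _))// lerD.
Qed.

Lemma adjE {R : rcfType} m n (A : 'M[R[i]]_(m, n)) i j : (A^t*) i j = (A j i)^*.
Proof. by rewrite !mxE. Qed.

Lemma adjM {R : rcfType} m n p (A : 'M[R[i]]_(m, n)) (B : 'M[R[i]]_(n, p)) :
  (A *m B)^t* = B^t* *m A^t*.
Proof. by rewrite trmx_mul map_mxM. Qed.

Lemma adjK {R : rcfType} m n (A : 'M[R[i]]_(m, n)) : (A^t*)^t* = A.
Proof. by apply/matrixP => i j; rewrite !adjE conjcK. Qed.

Lemma mxtrace_adj {R : rcfType} n (A : 'M[R[i]]_n) : \tr (A^t*) = (\tr A)^*.
Proof. by rewrite /mxtrace rmorph_sum; apply: eq_bigr => i _; rewrite adjE. Qed.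

Section MatrixNorm.
Context {R : rcfType}.

(** The entrywise l1 norm is subadditive and submultiplicative with constant 1, for rectangular
    matrices too, whereas the estimates for [hsnorm] concern squares and lose factors. The two are
    equivalent up to [L ^ 2]. *)
Definition mnorm m n (A : 'M[R[i]]_(m, n)) : R := \sum_i \sum_j normc (A i j).

Lemma mnorm_ge0 m n (A : 'M[R[i]]_(m, n)) : 0 <= mnorm A.
Proof. by do 2 apply: sumr_ge0 => ? _; exact: normc_ge0. Qed.

Lemma mnorm0 m n : mnorm (0 : 'M[R[i]]_(m, n)) = 0.
Proof. by do 2 rewrite /mnorm big1// => ? _; rewrite mxE Normc.normc0. Qed.

Lemma mnormD m n (A B : 'M[R[i]]_(m, n)) : mnorm (A + B) <= mnorm A + mnorm B.
Proof.
rewrite -big_split/=; apply: ler_sum => i _; rewrite -big_split/=.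
by apply: ler_sum => j _; rewrite mxE le_normcD.
Qed.

Lemma mnormN m n (A : 'M[R[i]]_(m, n)) : mnorm (- A) = mnorm A.
Proof. by do 2 apply: eq_bigr => ? _; rewrite mxE normcN. Qed.

Lemma mnormB m n (A B : 'M[R[i]]_(m, n)) : mnorm (A - B) <= mnorm A + mnorm B.
Proof. by rewrite -(mnormN B) mnormD. Qed.

Lemma mnorm_distC m n (A B : 'M[R[i]]_(m, n)) : mnorm (A - B) = mnorm (B - A).
Proof. by rewrite -mnormN opprB. Qed.

Lemma mnorm_distD m n (B A C : 'M[R[i]]_(m, n)) :
  mnorm (A - C) <= mnorm (A - B) + mnorm (B - C).
Proof. by rewrite -{1}(subrK B A) -addrA mnormD. Qed.

Lemma mnormZ m n (a : R[i]) (A : 'M[R[i]]_(m, n)) :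
  mnorm (a *: A) = normc a * mnorm A.
Proof.
rewrite mulr_sumr; apply: eq_bigr => i _; rewrite mulr_sumr.
by apply: eq_bigr => j _; rewrite mxE Normc.normcM.
Qed.

Lemma normc_le_mnorm m n (A : 'M[R[i]]_(m, n)) i j : normc (A i j) <= mnorm A.
Proof.
rewrite /mnorm (bigD1 i)//= (bigD1 j)//= -addrA lerDl addr_ge0//.
  by apply: sumr_ge0 => ? _; exact: normc_ge0.
by do 2 apply: sumr_ge0 => ? _; exact: normc_ge0.
Qed.

Lemma mnormM m n p (A : 'M[R[i]]_(m, n)) (B : 'M[R[i]]_(n, p)) :
  mnorm (A *m B) <= mnorm A * mnorm B.
Proof.
rewrite /mnorm mulr_suml; apply: ler_sum => i _.
rewrite mulr_suml (le_trans (y := \sum_j \sum_k normc (A i k) * normc (B k j)))//.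
  apply: ler_sum => j _; rewrite mxE (le_trans (normc_sum_le _ _ _))//.
  by apply: ler_sum => k _; rewrite Normc.normcM.
rewrite exchange_big/=; apply: ler_sum => k _; rewrite -mulr_sumr.
rewrite ler_wpM2l ?normc_ge0// [leRHS](bigD1 k)//= lerDl.
by do 2 apply: sumr_ge0 => ? _; exact: normc_ge0.
Qed.

Lemma mnorm_eq0 m n (A : 'M[R[i]]_(m, n)) : mnorm A <= 0 -> A = 0.
Proof.
move=> A0; apply/matrixP => i j; rewrite mxE; apply: Normc.eq0_normc.
by apply/eqP; rewrite eq_le normc_ge0 (le_trans (normc_le_mnorm A i j)).
Qed.

Lemma mnorm_adj m n (A : 'M[R[i]]_(m, n)) : mnorm (A^t*) = mnorm A.
Proof.
rewrite /mnorm exchange_big/=; do 2 apply: eq_bigr => ? _.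
by rewrite adjE normc_conj.
Qed.

End MatrixNorm.

Section HsnormMnorm.
Context {R : realType} {L : nat}.
Implicit Types A B : 'M[R[i]]_L.

Lemma hsnormE A : hsnorm A ^+ 2 = \sum_i \sum_j normc (A i j) ^+ 2.
Proof.
by rewrite hsnorm_sqr; do 2 apply: eq_bigr => ? _; rewrite sqr_normcE.
Qed.

Lemma hsnorm_eq0 A : hsnorm A ^+ 2 <= 0 -> A = 0.
Proof.
move=> A0; apply/matrixP => i j; rewrite mxE; apply: Normc.eq0_normc.
apply/eqP; rewrite -sqrf_eq0 eq_le sqr_ge0 andbT (le_trans _ A0)// hsnormE.
rewrite (bigD1 i)//= (bigD1 j)//= -addrA lerDl addr_ge0//.
  by apply: sumr_ge0 => ? _; exact: sqr_ge0.
by do 2 apply: sumr_ge0 => ? _; exact: sqr_ge0.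
Qed.

Lemma hsnorm_le_mnorm A : hsnorm A <= mnorm A.
Proof.
rewrite -ler_sqr ?nnegrE ?mnorm_ge0 ?hsnorm_ge0// hsnormE.
rewrite [leRHS]expr2 [X in _ <= X * _]/mnorm mulr_suml; apply: ler_sum => i _.
rewrite mulr_suml; apply: ler_sum => j _; rewrite expr2.
by rewrite ler_wpM2l ?normc_ge0 ?normc_le_mnorm.
Qed.

Lemma mnorm_le_hsnorm A : mnorm A <= L%:R ^+ 2 * hsnorm A.
Proof.
have -> : L%:R ^+ 2 * hsnorm A = \sum_(i < L) \sum_(j < L) hsnorm A.
  by rewrite !sumr_const card_ord -mulrnA -[RHS]mulr_natl natrM expr2.
apply: ler_sum => i _; apply: ler_sum => j _.
rewrite -ler_sqr ?nnegrE ?normc_ge0 ?hsnorm_ge0// hsnormE.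
rewrite (bigD1 i)//= (bigD1 j)//= -addrA lerDl addr_ge0//.
  by apply: sumr_ge0 => ? _; exact: sqr_ge0.
by do 2 apply: sumr_ge0 => ? _; exact: sqr_ge0.
Qed.

End HsnormMnorm.

Section Convergence.
Context {R : realType} {T : Type} {F : set_system T} {FF : Filter F}.

Lemma cvg0_le (f g : T -> R) : (\forall x \near F, 0 <= f x <= g x) ->
  g x @[x --> F] --> 0 -> f x @[x --> F] --> 0.
Proof. by move=> fg g0; apply: (squeeze_cvgr fg) => //; exact: cvg_cst. Qed.

Lemma cvg0D (f g : T -> R) : f x @[x --> F] --> 0 -> g x @[x --> F] --> 0 ->
  f x + g x @[x --> F] --> 0.
Proof. by move=> f0 g0; rewrite -[X in _ --> X]addr0; exact: cvgD. Qed.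

Lemma cvg0M (f g : T -> R) (l : R) : f x @[x --> F] --> 0 -> g x @[x --> F] --> l ->
  f x * g x @[x --> F] --> 0.
Proof. by move=> f0 g0; rewrite -[X in _ --> X](mul0r l); exact: cvgM. Qed.

(** Convergence is a statement about real distances, so that every limit rule below is an inequality
    followed by the squeeze [cvg0_le], over an arbitrary filter. *)
Definition ccvg (f : T -> R[i]) (a : R[i]) := normc (f x - a) @[x --> F] --> (0 : R).

Definition mcvg m n (f : T -> 'M[R[i]]_(m, n)) (A : 'M[R[i]]_(m, n)) :=
  mnorm (f x - A) @[x --> F] --> (0 : R).

Lemma ccvg_cst (a : R[i]) : ccvg (fun=> a) a.
Proof. by rewrite /ccvg subrr Normc.normc0; exact: cvg_cst. Qed.

Lemma ccvgD f g a b : ccvg f a -> ccvg g b -> ccvg (fun x => f x + g x) (a + b).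
Proof.
move=> fa gb; apply: cvg0_le (cvg0D fa gb); apply: nearW => x.
by rewrite normc_ge0/= opprD addrACA le_normcD.
Qed.

Lemma ccvgN f a : ccvg f a -> ccvg (fun x => - f x) (- a).
Proof.
move=> fa; apply: cvg0_le fa; apply: nearW => x.
by rewrite normc_ge0/= -opprD normcN.
Qed.

Lemma ccvgM f g a b : ccvg f a -> ccvg g b -> ccvg (fun x => f x * g x) (a * b).
Proof.
move=> fa gb.
have h : normc (f x - a) * normc (g x - b) +
   (normc (f x - a) * normc b + normc (g x - b) * normc a) @[x --> F] --> 0.
  apply: cvg0D; first exact: cvg0M fa gb.
  by apply: cvg0D; [apply: cvg0M fa _|apply: cvg0M gb _]; exact: cvg_cst.
apply: cvg0_le h; apply: nearW => x; rewrite normc_ge0/=.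
have -> : f x * g x - a * b =
  (f x - a) * (g x - b) + ((f x - a) * b + (g x - b) * a) by ring.
rewrite -!Normc.normcM (le_trans (le_normcD _ _))// lerD2l.
exact: le_normcD.
Qed.

Lemma ccvg_conj f a : ccvg f a -> ccvg (fun x => (f x)^*) a^*.
Proof.
move=> fa; apply: cvg0_le fa; apply: nearW => x.
by rewrite normc_ge0/= -rmorphB normc_conj.
Qed.

Lemma ccvgX f a n : ccvg f a -> ccvg (fun x => f x ^+ n) (a ^+ n).
Proof.
move=> fa; elim: n => [|n IHn]; first exact: ccvg_cst.
rewrite exprS (_ : (fun x => _) = fun x => f x * f x ^+ n); first exact: ccvgM.
by apply/funext => x; rewrite exprS.
Qed.

Lemma cvg0_lt (f : T -> R) (e : R) : 0 < e -> f x @[x --> F] --> 0 ->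
  \forall x \near F, f x < e.
Proof. by move=> e0 f0; exact: cvgr_lt f0 _ e0. Qed.

Lemma ccvg_near_ge f a : a != 0 -> ccvg f a ->
  \forall x \near F, normc a / 2 <= normc (f x).
Proof.
rewrite -normc_gt0 => a0 /(@cvg0_lt _ (normc a / 2)) fa.
have {}fa := fa (divr_gt0 a0 (ltr0Sn _ _)).
near=> x; have : normc (f x - a) < normc a / 2 by near: x.
have := le_normcD (f x) (a - f x); rewrite addrC subrK normcB; lra.
Unshelve. all: by end_near. Qed.

Lemma ccvgV f a : a != 0 -> ccvg f a -> ccvg (fun x => (f x)^-1) a^-1.
Proof.
move=> a0 fa; have fa2 := ccvg_near_ge a0 fa.
have na0 : 0 < normc a by rewrite normc_gt0.
have h : normc (f x - a) * (2 / normc a ^+ 2) @[x --> F] --> 0.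
  by apply: cvg0M fa _; exact: cvg_cst.
apply: cvg0_le h; near=> x.
have fx : normc a / 2 <= normc (f x) by near: x.
have nf0 : 0 < normc (f x) by rewrite (lt_le_trans _ fx)// divr_gt0.
have f0 : f x != 0 by rewrite -normc_gt0.
rewrite normc_ge0/= (_ : (f x)^-1 - a^-1 = (a - f x) * ((f x)^-1 * a^-1)).
  rewrite !Normc.normcM !Normc.normcV normcB ler_wpM2l ?normc_ge0//.
  rewrite expr2 invfM mulrA ler_pM2r ?invr_gt0//.
  by rewrite -invf_div lef_pV2 ?posrE// divr_gt0.
by field; rewrite f0 a0.
Unshelve. all: by end_near. Qed.

Lemma ccvgXz f a (n : int) : a != 0 -> ccvg f a ->
  ccvg (fun x => (f x ^ n)%R) (a ^ n)%R.
Proof.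
move=> a0 fa; case: n => n; first exact: ccvgX.
rewrite NegzE -exprnN.
rewrite (_ : (fun x => _) = fun x => (f x ^+ n.+1)^-1).
  by apply: ccvgV; [rewrite expf_neq0|exact: ccvgX].
by apply/funext => x; rewrite -exprnN.
Qed.

Section Matrices.
Variables m n p : nat.
Implicit Types (f g : T -> 'M[R[i]]_(m, n)) (A B : 'M[R[i]]_(m, n)).

Lemma mcvg_cst A : mcvg (fun=> A) A.
Proof. by rewrite /mcvg subrr mnorm0; exact: cvg_cst. Qed.

Lemma mcvgD f g A B : mcvg f A -> mcvg g B -> mcvg (fun x => f x + g x) (A + B).
Proof.
move=> fA gB; apply: cvg0_le (cvg0D fA gB); apply: nearW => x.
by rewrite mnorm_ge0/= opprD addrACA mnormD.
Qed.

Lemma mcvgB f g A B : mcvg f A -> mcvg g B -> mcvg (fun x => f x - g x) (A - B).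
Proof.
move=> fA gB; apply: cvg0_le (cvg0D fA gB); apply: nearW => x.
by rewrite mnorm_ge0/= opprD addrACA -opprD mnormB.
Qed.

Lemma mcvgZ (c : T -> R[i]) f a A : ccvg c a -> mcvg f A ->
  mcvg (fun x => c x *: f x) (a *: A).
Proof.
move=> ca fA.
have h : normc (c x - a) * mnorm (f x - A) +
   (normc (c x - a) * mnorm A + mnorm (f x - A) * normc a) @[x --> F] --> 0.
  apply: cvg0D; first exact: cvg0M ca fA.
  by apply: cvg0D; [apply: cvg0M ca _|apply: cvg0M fA _]; exact: cvg_cst.
apply: cvg0_le h; apply: nearW => x; rewrite mnorm_ge0/=.
have -> : c x *: f x - a *: A =
  (c x - a) *: (f x - A) + ((c x - a) *: A + a *: (f x - A)).
  by rewrite addrA -scalerDr subrK scalerBl scalerBr addrA subrK.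
rewrite [X in _ <= _ + (_ + X)]mulrC -!mnormZ (le_trans (mnormD _ _))// lerD2l.
exact: mnormD.
Qed.

Lemma mcvg_adj f A : mcvg f A -> mcvg (fun x => (f x)^t*) (A^t*).
Proof.
move=> fA; apply: cvg0_le fA; apply: nearW => x.
have -> : (f x)^t* - A^t* = (f x - A)^t* by rewrite linearB/= map_mxB.
by rewrite mnorm_ge0/= mnorm_adj.
Qed.

Lemma mcvgM f (g : T -> 'M[R[i]]_(n, p)) A (B : 'M[R[i]]_(n, p)) : mcvg f A -> mcvg g B ->
  mcvg (fun x => f x *m g x) (A *m B).
Proof.
move=> fA gB.
have h : mnorm (f x - A) * mnorm (g x - B) +
   (mnorm (f x - A) * mnorm B + mnorm (g x - B) * mnorm A) @[x --> F] --> 0.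
  apply: cvg0D; first exact: cvg0M fA gB.
  by apply: cvg0D; [apply: cvg0M fA _|apply: cvg0M gB _]; exact: cvg_cst.
apply: cvg0_le h; apply: nearW => x; rewrite mnorm_ge0/=.
have -> : f x *m g x - A *m B =
  (f x - A) *m (g x - B) + ((f x - A) *m B + A *m (g x - B)).
  by rewrite addrA -mulmxDr subrK mulmxBl mulmxBr addrA subrK.
rewrite (le_trans (mnormD _ _))// lerD ?mnormM// (le_trans (mnormD _ _))//.
by rewrite lerD ?mnormM// mulrC mnormM.
Qed.

Lemma mcvg_unique {PF : ProperFilter F} f A B : mcvg f A -> mcvg f B -> A = B.
Proof.
move=> fA fB; apply/subr0_eq/mnorm_eq0.
have /cvg_lim : (fun=> mnorm (A - B)) x @[x --> F] --> (0 : R).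
  apply: cvg0_le (cvg0D fA fB); apply: nearW => x.
  by rewrite mnorm_ge0/= (mnorm_distC (f x) A) mnorm_distD.
by rewrite lim_cst// => ->.
Qed.

Lemma mcvg_norm_le f A (c : R) {PF : ProperFilter F} :
  (\forall x \near F, mnorm (f x) <= c) -> mcvg f A -> mnorm A <= c.
Proof.
move=> fc fA; apply/ler_addgt0Pr => e e0.
have /(cvg0_lt e0) := fA => h.
have : \forall x \near F, mnorm A <= c + e.
  near=> x; have := mnormD (A - f x) (f x); rewrite subrK => /le_trans; apply.
  by rewrite addrC lerD//; [near: x|rewrite mnorm_distC; apply/ltW; near: x].
by move=> /filter_ex[].
Unshelve. all: by end_near. Qed.

End Matrices.

(** The norm of the identity appears because [mnorm] does not give it norm 1. *)
Lemma unitmx_perturb n (A B : 'M[R[i]]_n) : A \in unitmx ->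
  mnorm (invmx A) * mnorm (B - A) <= 2^-1 ->
  B \in unitmx /\ mnorm (invmx B) <= 2 * mnorm (invmx A) * mnorm (1%:M : 'M[R[i]]_n).
Proof.
move=> uA BA.
(* Absorbing the perturbation term of this decomposition of [X] makes [B] bounded below. With [X]
   the cokernel of [B] this gives invertibility, with [X] the inverse it gives the norm bound. *)
have inj p (X : 'M[R[i]]_(n, p)) : mnorm X <= 2 * mnorm (invmx A) * mnorm (B *m X).
  have : X = invmx A *m (B *m X) - invmx A *m ((B - A) *m X).
    by rewrite -mulmxBr -mulmxBl opprB addrC subrK mulKmx.
  move=> /(congr1 (@mnorm R n p)) XE.
  have := mnormB (invmx A *m (B *m X)) (invmx A *m ((B - A) *m X)).
  rewrite -XE => h.
  have h1 := mnormM (invmx A) (B *m X).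
  have h2 := le_trans (mnormM (invmx A) ((B - A) *m X)) (ler_wpM2l (mnorm_ge0 _) (mnormM _ _)).
  have h3 : mnorm (invmx A) * (mnorm (B - A) * mnorm X) <= 2^-1 * mnorm X.
    by rewrite mulrA ler_wpM2r ?mnorm_ge0.
  lra.
have uB : B \in unitmx.
  have : cokermx B = 0.
    apply: mnorm_eq0; rewrite (le_trans (inj _ _))// mulmx_coker mnorm0 mulr0//.
  by move=> /eqP; rewrite cokermx_eq0 row_full_unit.
by split=> //; have := inj n (invmx B); rewrite mulmxV.
Qed.

Lemma mcvg_inv n (f : T -> 'M[R[i]]_n) A : A \in unitmx -> mcvg f A ->
  (\forall x \near F, f x \in unitmx) /\ mcvg (fun x => invmx (f x)) (invmx A).
Proof.
move=> uA fA.
have h : mnorm (f x - A) * mnorm (invmx A) @[x --> F] --> 0.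
  by apply: cvg0M fA _; exact: cvg_cst.
have hF : \forall x \near F, mnorm (invmx A) * mnorm (f x - A) < 2^-1.
  near=> x; rewrite mulrC; near: x; apply: cvg0_lt h; by rewrite invr_gt0.
have uF : \forall x \near F, f x \in unitmx.
  near=> x; have : mnorm (invmx A) * mnorm (f x - A) < 2^-1 by near: x.
  by move=> /ltW /(unitmx_perturb uA)[].
split=> //.
have h' : mnorm (f x - A) * (2 * mnorm (invmx A) * mnorm (1%:M : 'M[R[i]]_n) *
   mnorm (invmx A)) @[x --> F] --> 0.
  by apply: cvg0M fA _; exact: cvg_cst.
apply: cvg0_le h'; near=> x; rewrite mnorm_ge0/=.
have ux : f x \in unitmx by near: x.
have : mnorm (invmx A) * mnorm (f x - A) < 2^-1 by near: x.
move=> /ltW /(unitmx_perturb uA)[_ le_inv].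
have -> : invmx (f x) - invmx A = invmx (f x) *m (A - f x) *m invmx A.
  by rewrite mulmxBr mulmxBl mulVmx// mul1mx mulmxK.
rewrite (le_trans (mnormM _ _))// mulrA ler_wpM2r ?mnorm_ge0//.
rewrite (le_trans (mnormM _ _))// mulrC mnorm_distC ler_wpM2l ?mnorm_ge0//.
Unshelve. all: by end_near. Qed.

End Convergence.

Section Completeness.
Context {R : realType}.

Lemma cvgn_of_summable_increments (r t : nat -> R) (S : R) :
  (forall k, `|r k.+1 - r k| <= t k) -> (forall k, \sum_(i < k) t i <= S) ->
  cvgn r.
Proof.
move=> rt tS.
have t0 k : 0 <= t k by rewrite (le_trans _ (rt k)).
have ct : cvgn (series t).
  apply: nondecreasing_is_cvgn.
    by apply/nondecreasing_seqP => n; rewrite /series/= big_nat_recr//= lerDl.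
  by exists S => _ [k _ <-]; rewrite /series/= big_mkord.
have /normed_cvg cd : cvgn (series (fun k => `|r k.+1 - r k|)).
  by apply: series_le_cvg ct => // k.
have -> : r = (fun=> r 0%N) \+ series (fun k => r k.+1 - r k).
  apply/funext => k /=; rewrite /series/= telescope_sumr//.
  by rewrite addrC subrK.
by apply: is_cvgD => //; exact: is_cvg_cst.
Qed.

Lemma cvg0_sum (I : Type) (s : seq I) (f : I -> nat -> R) :
  (forall i, f i k @[k --> \oo] --> 0) -> \sum_(i <- s) f i k @[k --> \oo] --> 0.
Proof.
move=> f0; elim: s => [|i s IHs].
  by under eq_fun do rewrite big_nil; exact: cvg_cst.
by under eq_fun do rewrite big_cons; exact: cvg0D.
Qed.

(** Completeness, entry by entry: real and imaginary parts have increments dominated by [t]. *)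
Lemma mcvg_of_summable_increments m n (x : nat -> 'M[R[i]]_(m, n)) (t : nat -> R) (S : R) :
  (forall k, mnorm (x k.+1 - x k) <= t k) -> (forall k, \sum_(i < k) t i <= S) ->
  exists A, mcvg (F := \oo) x A.
Proof.
move=> xt tS.
have cRe i j : cvgn (fun k => complex.Re (x k i j)).
  apply: cvgn_of_summable_increments tS => k; apply: le_trans (xt k).
  apply: le_trans (normc_le_mnorm _ i j); apply: le_trans (normc_Re_le _).
  by rewrite !mxE; case: (x k.+1 i j) (x k i j) => [? ?] [? ?].
have cIm i j : cvgn (fun k => complex.Im (x k i j)).
  apply: cvgn_of_summable_increments tS => k; apply: le_trans (xt k).
  apply: le_trans (normc_le_mnorm _ i j); apply: le_trans (normc_Im_le _).
  by rewrite !mxE; case: (x k.+1 i j) (x k i j) => [? ?] [? ?].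
pose A := \matrix_(i < m, j < n) (lim (complex.Re (x k i j) @[k --> \oo])
  +i* lim (complex.Im (x k i j) @[k --> \oo])).
exists A; have h : (fun k => \sum_i \sum_j
    (`|complex.Re (x k i j) - complex.Re (A i j)| +
     `|complex.Im (x k i j) - complex.Im (A i j)|)) @ \oo --> (0 : R).
  apply: cvg0_sum => i; apply: cvg0_sum => j.
  apply: cvg0D; rewrite -[X in _ --> X](normr0 R); apply: cvg_norm.
    rewrite -(subrr (complex.Re (A i j))); apply: cvgB; last exact: cvg_cst.
    by rewrite /A mxE/=; exact: cRe.
  rewrite -(subrr (complex.Im (A i j))); apply: cvgB; last exact: cvg_cst.
  by rewrite /A mxE/=; exact: cIm.
apply: cvg0_le h; apply: nearW => k; rewrite mnorm_ge0/=.
apply: ler_sum => i _; apply: ler_sum => j _.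
apply: le_trans (normc_le_ReIm _) _.
by rewrite !mxE; case: (x k i j) => ? ?.
Qed.

Lemma mnorm_increments_le m n (x : nat -> 'M[R[i]]_(m, n)) (t : nat -> R) p k :
  (forall k, mnorm (x k.+1 - x k) <= t k) ->
  mnorm (x (p + k)%N - x p) <= \sum_(i < k) t (p + i)%N.
Proof.
move=> xt; elim: k => [|k IHk]; first by rewrite addn0 subrr mnorm0 big_ord0.
rewrite big_ord_recr addnS/= addrC (le_trans (mnorm_distD (x (p + k)%N) _ _))//.
by rewrite lerD.
Qed.

Lemma mcvg_increments_le m n (x : nat -> 'M[R[i]]_(m, n)) (t : nat -> R) A p (S : R) :
  (forall k, mnorm (x k.+1 - x k) <= t k) -> mcvg (F := \oo) x A ->
  (forall k, \sum_(i < k) t (p + i)%N <= S) -> mnorm (A - x p) <= S.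
Proof.
move=> xt xA tS; apply: mcvg_norm_le (mcvgB xA (mcvg_cst (F := \oo) (x p))); exists p => // k /= pk.
by rewrite -(subnKC pk) (le_trans (mnorm_increments_le _ _ xt)).
Qed.

End Completeness.

(** * Existence of the resolvent *)

Section IntegerSums.
Context {R : realType}.
Implicit Types f g : int -> R.

(** Nonnegativity is part of the notion since [esum] adds, scales and reindexes only nonnegative
    terms. *)
Definition zfin f := (forall n, 0 <= f n) /\ (\esum_(n in setT) (f n)%:E < +oo)%E.

Definition zsum f : R := fine (\esum_(n in setT) (f n)%:E).

Lemma esum_le_seqP f (c : R) : (\esum_(n in setT) (f n)%:E <= c%:E)%E <->
  (forall s : seq int, uniq s -> \sum_(n <- s) f n <= c).
Proof.
split=> [fc s us|fc].
  rewrite -lee_fin -sumEFin (le_trans _ fc)//; apply: esum_ge.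
  exists [set` s]; first by split=> //; exact: finite_seq.
  by rewrite fsbig_seq.
apply: ge_ereal_sup => _ [A [Afin _] <-].
by rewrite fsbig_finite//= sumEFin lee_fin fc// fset_uniq.
Qed.

Lemma zfin_le_seqP f (c : R) : (forall n, 0 <= f n) ->
  (forall s : seq int, uniq s -> \sum_(n <- s) f n <= c) -> zfin f /\ zsum f <= c.
Proof.
move=> f0 /esum_le_seqP fc.
have ffin : (\esum_(n in setT) (f n)%:E < +oo)%E by rewrite (le_lt_trans fc)// ltry.
split=> //; rewrite -lee_fin fineK// ge0_fin_numE//.
by apply: esum_ge0 => n _; rewrite lee_fin.
Qed.

Lemma zsumE f : zfin f -> (\esum_(n in setT) (f n)%:E)%E = (zsum f)%:E.
Proof.
move=> [f0 ffin]; rewrite fineK// ge0_fin_numE//.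
by apply: esum_ge0 => n _; rewrite lee_fin.
Qed.

Lemma zsum_seq_le f s : zfin f -> uniq s -> \sum_(n <- s) f n <= zsum f.
Proof. by move=> ff; apply: (proj1 (esum_le_seqP f (zsum f))); rewrite zsumE. Qed.

Lemma zsum_ge f n : zfin f -> f n <= zsum f.
Proof. by move=> ff; have := @zsum_seq_le f [:: n] ff isT; rewrite big_seq1. Qed.

Lemma zsum_ge0 f : zfin f -> 0 <= zsum f.
Proof. by move=> ff; rewrite (le_trans _ (zsum_ge 0 ff))//; case: ff. Qed.

Lemma zsum_le f g : (forall n, 0 <= f n <= g n) -> zfin g ->
  zfin f /\ zsum f <= zsum g.
Proof.
move=> fg gfin; apply: zfin_le_seqP => [n|s us]; first by have /andP[] := fg n.
apply: le_trans (zsum_seq_le gfin us); apply: ler_sum => n _.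
by have /andP[] := fg n.
Qed.

(** Carrying the value along with summability lets sums be added, scaled and shifted as wholes, so
    that two evaluations of one sum can be equated at the end. *)
Definition zhas f (c : R) := zfin f /\ zsum f = c.

Lemma zhas_zsum f : zfin f -> zhas f (zsum f). Proof. by []. Qed.

Lemma zhasD f g c d : zhas f c -> zhas g d -> zhas (fun n => f n + g n) (c + d).
Proof.
move=> [ff <-] [gf <-].
have E : (\esum_(n in setT) (f n + g n)%:E = (zsum f + zsum g)%:E)%E.
  under eq_esum do rewrite EFinD.
  rewrite esumD ?zsumE// => n _; rewrite lee_fin; [by case: ff|by case: gf].
split; last by rewrite /zsum E.
split; last by rewrite E ltry.
by move=> n; rewrite addr_ge0//; [case: ff|case: gf].
Qed.

Lemma zhasZ (a : R) f c : 0 <= a -> zhas f c -> zhas (fun n => a * f n) (a * c).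
Proof.
move=> a0.
have le d g : 0 <= d -> zfin g ->
    zfin (fun n => d * g n) /\ zsum (fun n => d * g n) <= d * zsum g.
  move=> d0 gf; apply: zfin_le_seqP => [n|s us].
    by rewrite mulr_ge0//; case: gf.
  by rewrite -mulr_sumr ler_wpM2l// zsum_seq_le.
move=> [ff <-]; have [af ale] := le _ _ a0 ff; split=> //.
apply/eqP; rewrite eq_le ale/=; have [a00|a00] := eqVneq a 0.
  by rewrite a00 mul0r zsum_ge0// -a00.
have {}a0 : 0 < a by rewrite lt_neqAle eq_sym a00.
(* The reverse inequality is the same one with factor [a^-1], applied to the scaled function. *)
have [_] := le a^-1 _ (ltW (etrans (invr_gt0 a) a0)) af.
under [X in zsum X <= _]eq_fun do rewrite mulrA mulVf// mul1r.
by rewrite mulrC ler_pdivlMr// mulrC.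
Qed.

Lemma zhas_shift k f c : zhas f c -> zhas (fun n => f (n + k)) c.
Proof.
move=> [ff <-]; have shift_bij : set_bij setT setT (fun n : int => n + k).
  split=> // [n m _ _|m _]; first exact: addIr.
  by exists (m - k); rewrite ?subrK.
have E := reindex_esum _ _ _ (fun n => (f n)%:E) shift_bij.
split; last by rewrite /zsum [in RHS]E.
by split=> [n|]; [case: ff|rewrite -E; case: ff].
Qed.

End IntegerSums.

Section ImaginaryTrace.
Context {R : realType} {L : nat}.
Implicit Types A B : 'M[R[i]]_L.

(** The imaginary part of [tr (A^* B)], in real coordinates so that identities reduce to [ring] on
    entries. *)
Definition imdot A B : R := \sum_i \sum_j
  (complex.Re (A i j) * complex.Im (B i j) - complex.Im (A i j) * complex.Re (B i j)).

Lemma imdotE A B : imdot A B = complex.Im (\tr (A^t* *m B)).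
Proof.
have ImD : {morph @complex.Im R : x y / x + y} by move=> [? ?] [? ?].
rewrite /mxtrace (big_morph _ ImD (erefl : complex.Im 0 = 0)).
rewrite /imdot exchange_big/=; apply: eq_bigr => j _.
rewrite mxE (big_morph _ ImD (erefl : complex.Im 0 = 0)); apply: eq_bigr => i _.
by rewrite adjE; case: (A i j) (B i j) => [a b] [c d] /=; ring.
Qed.

Lemma imdotC A B : imdot A B = - imdot B A.
Proof.
rewrite /imdot -sumrN; apply: eq_bigr => i _; rewrite -sumrN.
by apply: eq_bigr => j _; ring.
Qed.

Lemma imdotD A B C : imdot A (B + C) = imdot A B + imdot A C.
Proof.
rewrite /imdot -big_split; apply: eq_bigr => i _; rewrite -big_split.
apply: eq_bigr => j _; rewrite !mxE.
by case: (B i j) (C i j) => [a b] [c d] /=; ring.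
Qed.

Lemma imdotZ A (w : R[i]) : imdot A (w *: A) = complex.Im w * hsnorm A ^+ 2.
Proof.
rewrite hsnorm_sqr mulr_sumr; apply: eq_bigr => i _; rewrite mulr_sumr.
by apply: eq_bigr => j _; rewrite !mxE; case: w (A i j) => [a b] [c d] /=; ring.
Qed.

Lemma imdot_self_adjoint A B : B^t* = B -> imdot A (B *m A) = 0.
Proof.
move=> BB; have := mxtrace_adj (A^t* *m (B *m A)).
by rewrite !adjM BB adjK -mulmxA imdotE; case: (\tr _) => a b [] /=; lra.
Qed.

(** A local conservation law: since [W] is self-adjoint it drops out, leaving the difference of the
    fluxes through the two bonds at a site and the term with [Im w]. *)
Lemma imdot_tau A Ap Am W (w : R[i]) : W^t* = W ->
  imdot A (Ap + Am + W *m A - w *: A) =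
  imdot A Ap - imdot Am A - complex.Im w * hsnorm A ^+ 2.
Proof.
move=> WW; rewrite -scaleNr !imdotD imdotZ imdot_self_adjoint// addr0 (imdotC A Am).
by case: w => a b /=; rewrite mulNr.
Qed.

Lemma hsnorm_sqr_sub A B (t : R) :
  hsnorm (A - (0 +i* t) *: B) ^+ 2 =
  hsnorm A ^+ 2 + t ^+ 2 * hsnorm B ^+ 2 + 2 * t * imdot A B.
Proof.
rewrite !hsnorm_sqr !mulr_sumr -!big_split; apply: eq_bigr => i _ /=.
rewrite !mulr_sumr -!big_split; apply: eq_bigr => j _ /=.
by rewrite !mxE; case: (A i j) (B i j) => [a b] [c d] /=; ring.
Qed.

(** Entrywise this is [|t|] times a sum of two squares. Used for [t] and for [-t], it bounds a flux
    from both sides. *)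
Lemma imdot_le A B (t : R) :
  0 <= `|t| * (hsnorm A ^+ 2 + hsnorm B ^+ 2) + 2 * t * imdot A B.
Proof.
rewrite !hsnorm_sqr -big_split !mulr_sumr -!big_split; apply: sumr_ge0 => i _ /=.
rewrite -big_split !mulr_sumr -!big_split; apply: sumr_ge0 => j _ /=.
case: (A i j) (B i j) => [a b] [c d] /=.
have [t0|t0] := leP 0 t; first rewrite ger0_norm//; last rewrite ltr0_norm//.
  have := mulr_ge0 t0 (addr_ge0 (sqr_ge0 (a + d)) (sqr_ge0 (b - c))); lra.
have t0' : 0 <= - t by rewrite oppr_ge0 ltW.
have := mulr_ge0 t0' (addr_ge0 (sqr_ge0 (a - d)) (sqr_ge0 (b + c))); lra.
Qed.

End ImaginaryTrace.

(** * Energy identity and two-sided bounds for [H - w] *)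

Section Energy.
Context {R : realType} {L : nat} (V : int -> 'M[R[i]]_L).
Hypotheses (V_sa : self_adjoint V) (V_sum : summable_potential V).
Local Notation M := 'M[R[i]]_L.
Implicit Types (u v f : int -> M) (w : R[i]).

Definition sqnorm u : R := zsum (fun n => hsnorm (u n) ^+ 2).

Lemma l2_zfin u : u \in l2_pred <-> zfin (fun n => hsnorm (u n) ^+ 2).
Proof.
rewrite l2_predE; split=> [ul2|[]//]; split=> // n; exact: sqr_ge0.
Qed.

(** Defined on all sequences: it will also act on Jost solutions and on single branches of the Green
    function, which need not be square summable. *)
Definition shifted w u (n : int) : M := tau V u n - w *: u n.

Lemma shifted_l2 w u : u \in l2_pred -> shifted w u \in l2_pred.
Proof.
move=> ul2; have -> : shifted w u = tau V u - w *: u by [].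
by rewrite rpredB ?rpredZ ?tau_l2.
Qed.

(** Expanding the square at each site gives the cross term [imdot (u n) (v n)], which [imdot_tau]
    turns into a flux difference and a multiple of [|u n|^2]. The terms are distributed over the two
    sides so that all are nonnegative, which is where the sign of [t * Im w] enters. *)
Lemma energy_identity w (t : R) u : 0 <= t * complex.Im w -> u \in l2_pred ->
  sqnorm (fun n => u n - (0 +i* t) *: shifted w u n) +
    2 * (t * complex.Im w) * sqnorm u =
  sqnorm u + t ^+ 2 * sqnorm (shifted w u).
Proof.
move=> ty0 ul2; set y := complex.Im w.
have [v vdef] : {v | v = shifted w u} by exists (shifted w u).
have vl2 : v \in l2_pred by rewrite vdef shifted_l2.
rewrite -vdef.
pose g n := imdot (u n) (u (n + 1)).
(* The terms g telescope, but have no sign; h is nonnegative and so sums over int. *)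
pose h n := `|t| * (hsnorm (u n) ^+ 2 + hsnorm (u (n + 1)) ^+ 2) + 2 * t * g n.
have uf : zfin (fun n => hsnorm (u n) ^+ 2) by apply/l2_zfin.
have vf : zfin (fun n => hsnorm (v n) ^+ 2) by apply/l2_zfin.
have Tf : zfin (fun n => hsnorm (u n - (0 +i* t) *: v n) ^+ 2).
  apply/l2_zfin; have -> : (fun n => u n - (0 +i* t) *: v n) = u - (0 +i* t) *: v by [].
  by rewrite rpredB ?rpredZ.
have u0 := zhas_zsum uf; have u1 := zhas_shift 1 u0; have um1 := zhas_shift (-1) u0.
have t0 : 0 <= `|t| by [].
have hf : zfin h.
  have ts := zhasZ t0 (zhasD u0 u1); have [tsf _] := zhasD ts ts.
  apply: (proj1 (zsum_le _ tsf)) => n; rewrite imdot_le/= lerD2l.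
  by have := imdot_le (u n) (u (n + 1)) (- t); rewrite normrN mulrN mulNr subr_ge0.
have h0 := zhas_zsum hf; have hm1 := zhas_shift (-1) h0.
(* Beside [h (n - 1)] and [h n], shifted copies of [|t| |u|^2] balance what was added to the fluxes.
   After summation the two sums of [h] cancel, and so do the two shifted sums. *)
have pt n : hsnorm (u n - (0 +i* t) *: v n) ^+ 2 +
    (2 * (t * y) * hsnorm (u n) ^+ 2 + (h (n - 1) + `|t| * hsnorm (u (n + 1)) ^+ 2)) =
  hsnorm (u n) ^+ 2 + (t ^+ 2 * hsnorm (v n) ^+ 2 +
    (h n + `|t| * hsnorm (u (n - 1)) ^+ 2)).
  have h1 : h (n - 1) = `|t| * (hsnorm (u (n - 1)) ^+ 2 + hsnorm (u n) ^+ 2) +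
      2 * t * g (n - 1) by rewrite /h subrK.
  have vE : imdot (u n) (v n) = g n - g (n - 1) - y * hsnorm (u n) ^+ 2.
    by rewrite /g subrK vdef; exact: imdot_tau.
  rewrite (hsnorm_sqr_sub (u n) (v n) t) vE h1 /h.
  have alg (s r a am ap b gn gm : R) : a + s ^+ 2 * b + 2 * s * (gn - gm - y * a) +
      (2 * (s * y) * a + (r * (am + a) + 2 * s * gm + r * ap)) =
    a + (s ^+ 2 * b + (r * (a + ap) + 2 * s * gn + r * am)) by ring.
  exact: alg.
have [_ eL] := zhasD (zhas_zsum Tf)
  (zhasD (zhasZ (mulr_ge0 (ler0n R 2) ty0) u0) (zhasD hm1 (zhasZ t0 u1))).
have [_ eR] := zhasD u0
  (zhasD (zhasZ (sqr_ge0 t) (zhas_zsum vf)) (zhasD h0 (zhasZ t0 um1))).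
have := etrans (etrans (esym eL) (congr1 zsum (funext pt))) eR.
by rewrite !addrA => /addIr/addIr.
Qed.

Lemma sqnorm_ge0 u : u \in l2_pred -> 0 <= sqnorm u.
Proof. by move=> /l2_zfin; exact: zsum_ge0. Qed.

Lemma shifted_lower_bound w u : complex.Im w != 0 -> u \in l2_pred ->
  complex.Im w ^+ 2 * sqnorm u <= sqnorm (shifted w u).
Proof.
set y := complex.Im w => y0 ul2.
have := @energy_identity w y^-1 u; rewrite -/y mulVf// => /(_ ler01 ul2) e.
have : sqnorm u <= y^-1 ^+ 2 * sqnorm (shifted w u).
  have [v vE] : {v | v = shifted w u} by exists (shifted w u).
  have vl2 : v \in l2_pred by rewrite vE shifted_l2.
  rewrite -vE in e *.
  have T0 : 0 <= sqnorm (fun n => u n - (0 +i* y^-1) *: v n).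
    apply: sqnorm_ge0.
    have -> : (fun n => u n - (0 +i* y^-1) *: v n) = u - (0 +i* y^-1) *: v by [].
    by rewrite rpredB ?rpredZ.
  have alg (a b c : R) : 0 <= a -> a + 2 * 1 * b = b + c -> b <= c by lra.
  exact: alg T0 e.
have y2 : 0 < y ^+ 2 by rewrite lt_neqAle eq_sym sqrf_eq0 y0 sqr_ge0.
by rewrite exprVn mulrC ler_pdivlMr// mulrC.
Qed.

Lemma shifted_injective w u : complex.Im w != 0 -> u \in l2_pred ->
  (forall n, shifted w u n = 0) -> u = 0.
Proof.
move=> y0 ul2 su; apply/funext => n; apply: hsnorm_eq0.
have := shifted_lower_bound y0 ul2; have -> : shifted w u = 0 by exact/funext.
have -> : sqnorm (0 : int -> M) = 0.
  by rewrite /sqnorm /zsum esum1// => m _; rewrite hsnorm0 expr0n.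
rewrite pmulr_rle0; last by rewrite lt_neqAle eq_sym sqrf_eq0 y0 sqr_ge0.
by apply: le_trans; apply: (zsum_ge n); apply/l2_zfin.
Qed.

Fact le_four_terms (X P Q p m a b d q k e : R) :
  X <= 2 * P + 2 * Q -> P <= 2 * p + 2 * m -> Q <= 2 * a + 2 * b -> b = e * q ->
  a <= d -> d <= k * q -> X <= 4 * p + 4 * m + 4 * (k + e) * q.
Proof.
move=> h1 h2 h3 hb h4 h5.
have -> : 4 * (k + e) * q = 4 * (k * q) + 4 * (e * q) by ring.
by rewrite -hb; lra.
Qed.

(** Any constant will do: it only determines the step size [t] of the contraction. *)
Lemma shifted_upper_bound w : exists2 c : R, 0 <= c &
  forall u, u \in l2_pred -> sqnorm (shifted w u) <= c * sqnorm u.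
Proof.
have [c0 Vc] := summable_potential_bounded V_sum.
have c00 : 0 <= c0 by rewrite (le_trans _ (Vc 0)) ?sqr_ge0.
pose c1 : R := 4 * (2 * L%:R * c0 + normc w ^+ 2).
have c10 : 0 <= c1 by rewrite mulr_ge0// addr_ge0 ?sqr_ge0// !mulr_ge0.
exists (8 + c1) => [|u ul2]; first by rewrite addr_ge0.
have uf : zfin (fun n => hsnorm (u n) ^+ 2) by apply/l2_zfin.
have u0 := zhas_zsum uf; have u1 := zhas_shift 1 u0; have um1 := zhas_shift (-1) u0.
have [bf E] := zhasD (zhasD (zhasZ (ler0n R 4) u1) (zhasZ (ler0n R 4) um1)) (zhasZ c10 u0).
have -> : (8 + c1) * sqnorm u =
    4 * sqnorm u + 4 * sqnorm u + c1 * sqnorm u by ring.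
rewrite -E.
apply: (proj2 (zsum_le _ bf)) => n; rewrite sqr_ge0/= /shifted /tau.
rewrite -[_ + V n *m u n - _]addrA.
have h1 := hsnorm_sqrD (u (n + 1) + u (n - 1)) (V n *m u n - w *: u n).
have h2 := hsnorm_sqrD (u (n + 1)) (u (n - 1)).
have h3 := hsnorm_sqrD (V n *m u n) (- (w *: u n)).
have hw : hsnorm (- (w *: u n)) ^+ 2 = normc w ^+ 2 * hsnorm (u n) ^+ 2.
  by rewrite -scaleNr (hsnorm_sqrZ (- w) (u n)) -sqr_normcE normcN.
have h4 := hsnorm_sqrM (V n) (u n).
have h5 : 2 * L%:R * hsnorm (V n) ^+ 2 * hsnorm (u n) ^+ 2 <=
    2 * L%:R * c0 * hsnorm (u n) ^+ 2.
  by rewrite ler_wpM2r ?sqr_ge0// ler_wpM2l// mulr_ge0.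
exact: le_four_terms h1 h2 h3 hw h4 h5.
Qed.

End Energy.

(** * Inverting [H - w] by a Neumann series *)

Section ResolventExistence.
Context {R : realType} {L : nat} (V : int -> 'M[R[i]]_L).
Hypotheses (V_sa : self_adjoint V) (V_sum : summable_potential V).
Local Notation M := 'M[R[i]]_L.
Implicit Types (u v f : int -> M) (w : R[i]).

Lemma sqnormB u v : u \in l2_pred -> v \in l2_pred ->
  sqnorm (fun n => u n - v n) <= 2 * sqnorm u + 2 * sqnorm v.
Proof.
move=> /l2_zfin uf /l2_zfin vf.
have [sf <-] := zhasD (zhasZ (ler0n R 2) (zhas_zsum uf)) (zhasZ (ler0n R 2) (zhas_zsum vf)).
apply: (proj2 (zsum_le _ sf)) => n; rewrite sqr_ge0/=.
apply: le_trans (hsnorm_sqrD _ _) _.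
have -> : hsnorm (- v n) ^+ 2 = hsnorm (v n) ^+ 2.
  by rewrite !hsnormE; do 2 apply: eq_bigr => ? _; rewrite mxE normcN.
by [].
Qed.

Lemma shiftedD w u v (c : R[i]) n :
  shifted V w (fun m => u m + c *: v m) n = shifted V w u n + c *: shifted V w v n.
Proof.
rewrite /shifted /tau mulmxDr -scalemxAr.
move: (V n *m u n) (V n *m v n) => X Y.
by apply/matrixP => i j; rewrite !mxE; ring.
Qed.

Lemma shifted0 w n : shifted V w 0 n = 0.
Proof.
have -> : shifted V w 0 n = (0 : M) + 0 + V n *m 0 - w *: 0 by [].
by rewrite mulmx0 scaler0 !addr0 subrr.
Qed.

Lemma geometric_sum_le (q : R) k : 0 <= q < 1 -> \sum_(i < k) q ^+ i <= (1 - q)^-1.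
Proof.
move=> /andP[q0 q1]; have q1' : 0 < 1 - q by rewrite subr_gt0.
rewrite -[leRHS]mul1r ler_pdivlMr// mulrC.
by rewrite -[leLHS]opprK -mulNr opprB -subrX1 opprB gerBl exprn_ge0.
Qed.

(** A Fatou argument: over a finite set of sites, [|v|^2] is at most [2 |x k|^2] plus twice an error
    that vanishes as [k] grows. The lost factor 2 is harmless for membership. *)
Lemma l2_mcvg (x : nat -> int -> M) v (C : R) :
  (forall k, x k \in l2_pred) -> (forall k, sqnorm (x k) <= C) ->
  (forall n, mcvg (F := \oo) (fun k => x k n) (v n)) -> v \in l2_pred.
Proof.
move=> xl2 xC xv; apply/l2_zfin.
apply: (proj1 (@zfin_le_seqP _ _ (2 * C) (fun n => sqr_ge0 _) _)) => s us.
have h : \sum_(n <- s) 2 * (mnorm (x k n - v n) * mnorm (x k n - v n)) @[k --> \oo] --> (0 : R).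
  apply: cvg0_sum => n; rewrite -[X in _ --> X](mulr0 2).
  by apply: cvgM; [exact: cvg_cst|apply: cvg0M (xv n) _; exact: xv].
apply/ler_addgt0Pr => e e0; have := cvg0_lt e0 h; move=> [k _ /(_ k (leqnn k)) /= hk].
apply: (@le_trans _ _ (\sum_(n <- s) (2 * hsnorm (x k n) ^+ 2 +
    2 * (mnorm (x k n - v n) * mnorm (x k n - v n))))).
  apply: ler_sum => n _; have := hsnorm_sqrD (x k n) (v n - x k n).
  rewrite [x k n + _]addrC subrK => /le_trans; apply; rewrite lerD2l ler_pM2l//.
  rewrite -expr2 mnorm_distC lerXn2r ?nnegrE ?hsnorm_ge0 ?mnorm_ge0//.
  exact: hsnorm_le_mnorm.
rewrite big_split/=; apply: lerD; last exact/ltW.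
rewrite -mulr_sumr ler_pM2l//.
by apply: le_trans (xC k); apply: zsum_seq_le => //; apply/l2_zfin.
Qed.

Fact contraction_bound (a b d d' g : R) :
  a + 2 * g * b = b + d -> d <= d' -> d' = g * b -> a <= (1 - g) * b.
Proof. by rewrite mulrBl mul1r => + + e; rewrite e -mulrA; lra. Qed.

(** The limit of the partial sums is taken site by site, where convergence is geometric; that it is
    square summable follows from [l2_mcvg], the partial sums being bounded by
    [shifted_lower_bound]. *)
Lemma shifted_surjective w f : complex.Im w != 0 -> f \in l2_pred ->
  exists2 v, v \in l2_pred & shifted V w v = f.
Proof.
set y := complex.Im w => y0 fl2; have [c' c'0 shc] := shifted_upper_bound V_sum w.
have y2 : 0 < y ^+ 2 by rewrite lt_neqAle eq_sym sqrf_eq0 y0 sqr_ge0.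
pose c := 1 + y ^+ 2 + c'; have c0 : 0 < c by rewrite ltr_wpDr// addr_gt0.
(* This [t] minimizes [1 - 2 t y + t^2 c], the contraction factor from the energy identity, and [q]
   is the minimum. It is nonnegative because [c] exceeds [y ^ 2]. *)
pose t := y / c; pose q := 1 - y ^+ 2 / c.
have q01 : 0 <= q < 1.
  rewrite subr_ge0 ler_pdivrMr// mul1r ltrBlDr ltrDl divr_gt0// andbT /c; lra.
have ty0 : 0 <= t * y by rewrite /t mulrAC -expr2 divr_ge0// ltW.
pose T u n := u n - (0 +i* t) *: shifted V w u n.
have Tl2 u : u \in l2_pred -> T u \in l2_pred.
  move=> ul2; have [s sE] : {s | s = shifted V w u} by exists (shifted V w u).
  have sl2 : s \in l2_pred by rewrite sE shifted_l2.
  rewrite /T -sE; have -> : (fun n => u n - (0 +i* t) *: s n) = u - (0 +i* t) *: s by [].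
  by rewrite rpredB ?rpredZ.
have Tq u : u \in l2_pred -> sqnorm (T u) <= q * sqnorm u.
  move=> ul2; have e := energy_identity V_sa V_sum ty0 ul2.
  have h : t ^+ 2 * sqnorm (shifted V w u) <= t ^+ 2 * (c * sqnorm u).
    rewrite ler_wpM2l ?sqr_ge0// (le_trans (shc _ ul2))// ler_wpM2r ?sqnorm_ge0//.
    by rewrite /c lerDr addr_ge0 ?ltW.
  have tE : t ^+ 2 * (c * sqnorm u) = y ^+ 2 / c * sqnorm u.
    by rewrite /t; field; rewrite gt_eqF.
  have tyE : t * complex.Im w = y ^+ 2 / c by rewrite /t -/y mulrAC -expr2.
  by rewrite tyE in e; exact: contraction_bound e h tE.
(* [r k] is the residual left by the [k]-th approximation [x k]: the invariant is
   [(H - w) (x k) = f - r k]. *)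
have [r [r0 rS]] : exists r : nat -> int -> M, r 0%N = f /\ forall k, r k.+1 = T (r k).
  by exists (fun k => iter k T f).
have rl2 k : r k \in l2_pred by elim: k => [|k /Tl2]; rewrite ?r0 ?rS.
have rq k : sqnorm (r k) <= q ^+ k * sqnorm f.
  elim: k => [|k IHk]; first by rewrite expr0 mul1r r0.
  rewrite rS (le_trans (Tq _ (rl2 k)))// exprS -mulrA ler_wpM2l//.
  by case/andP: q01.
have [x [x0 xS]] : exists x : nat -> int -> M,
    x 0%N = 0 /\ forall k, x k.+1 = fun n => x k n + (0 +i* t) *: r k n.
  by exists (fix x (k : nat) : int -> M :=
    if k is k'.+1 then fun n => x k' n + (0 +i* t) *: r k' n else 0).
have xl2 k : x k \in l2_pred.
  elim: k => [|k IHk]; first by rewrite x0 l2_0.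
  have -> : x k.+1 = x k + (0 +i* t) *: r k by rewrite xS.
  by rewrite rpredD ?rpredZ.
have xr k n : shifted V w (x k) n = f n - r k n.
  elim: k n => [|k IHk] n; first by rewrite x0 r0 shifted0 subrr.
  by rewrite xS shiftedD IHk rS /T opprB addrA addrAC.
have rn k n : mnorm (r k n) <= L%:R ^+ 2 * Num.sqrt (sqnorm f) * Num.sqrt q ^+ k.
  rewrite -mulrA (le_trans (mnorm_le_hsnorm _))// ler_wpM2l ?exprn_ge0//.
  rewrite -ler_sqr ?nnegrE ?hsnorm_ge0 ?mulr_ge0 ?exprn_ge0 ?sqrtr_ge0//.
  rewrite exprMn (sqr_sqrtr (sqnorm_ge0 fl2)) exprAC (@sqr_sqrtr _ q); last by case/andP: q01.
  rewrite mulrC (le_trans _ (rq k))//; apply: (zsum_ge n); exact/l2_zfin.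
(* The contraction concerns squared norms, so single sites decay at rate [sqrt q]. *)
have sq01 : 0 <= Num.sqrt q < 1.
  by case/andP: q01 => q0 q1; rewrite sqrtr_ge0/= -sqrtr1 ltr_sqrt// ltr01.
have dn k n : mnorm (x k.+1 n - x k n) <=
    normc (0 +i* t) * (L%:R ^+ 2 * Num.sqrt (sqnorm f)) * Num.sqrt q ^+ k.
  by rewrite xS addrC addKr mnormZ -mulrA ler_wpM2l ?normc_ge0.
have C0 : 0 <= normc (0 +i* t) * (L%:R ^+ 2 * Num.sqrt (sqnorm f)).
  by rewrite !mulr_ge0 ?normc_ge0 ?sqrtr_ge0 ?exprn_ge0.
have ex n : exists A, mcvg (F := \oo) (fun k => x k n) A.
  apply: (mcvg_of_summable_increments (fun k => dn k n)) => k.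
  by rewrite -mulr_sumr; apply: (ler_wpM2l C0); exact: geometric_sum_le.
have [v xv] := choice ex.
exists v.
  (* The lower bound gives [y^2 |x k|^2 <= |f - r k|^2], and the residuals do not exceed [f] in
     norm. *)
  apply: (l2_mcvg (C := (y ^+ 2)^-1 * (2 * sqnorm f + 2 * sqnorm f)) xl2 _ xv) => k.
  rewrite mulrC ler_pdivlMr// mulrC (le_trans (shifted_lower_bound V_sa V_sum y0 (xl2 k)))//.
  rewrite (_ : shifted V w (x k) = fun n => f n - r k n); last exact/funext.
  rewrite (le_trans (sqnormB fl2 (rl2 k)))// lerD2l ler_pM2l// (le_trans (rq k))//.
  by case/andP: q01 => q0 /ltW q1; rewrite ler_piMl ?sqnorm_ge0// exprn_ile1.
apply/funext => n.
have lim1 : mcvg (F := \oo) (fun k => shifted V w (x k) n) (shifted V w v n).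
  apply: mcvgB; last by apply: mcvgZ (xv n); exact: ccvg_cst.
  apply: mcvgD; last by apply: mcvgM (xv n); exact: mcvg_cst.
  exact: mcvgD.
have lim2 : mcvg (F := \oo) (fun k => shifted V w (x k) n) (f n).
  rewrite (_ : (fun k => _) = fun k => f n - r k n); last exact/funext.
  suff rn0 : mcvg (F := \oo) (fun k => r k n) 0.
    have h : mcvg (F := \oo) (fun k => f n - r k n) (f n - 0).
      by apply: mcvgB => //; exact: mcvg_cst.
    by rewrite subr0 in h.
  have h : (L%:R ^+ 2 * Num.sqrt (sqnorm f)) * Num.sqrt q ^+ k @[k --> \oo] --> 0.
    rewrite -[X in _ --> X](mulr0 (L%:R ^+ 2 * Num.sqrt (sqnorm f))).
    apply: cvgM; first exact: cvg_cst.
    by apply: cvg_expr; case/andP: sq01 => s0 s1; rewrite ger0_norm.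
  by apply: cvg0_le h; apply: nearW => k; rewrite subr0 mnorm_ge0/= rn.
exact: mcvg_unique lim1 lim2.
Qed.

Lemma schrodinger_val w (u : ell2 R L) n :
  (schrodinger V_sum u - w *: u) n = shifted V w u n.
Proof. by []. Qed.

Lemma ell2_inj (u v : ell2 R L) : (forall n, u n = v n) -> u = v.
Proof. by move=> uv; apply: val_inj; exact/funext. Qed.

Lemma schrodinger_injective w (u v : ell2 R L) : complex.Im w != 0 ->
  schrodinger V_sum u - w *: u = schrodinger V_sum v - w *: v -> u = v.
Proof.
move=> y0 uv; apply: ell2_inj => n; apply: subr0_eq.
suff E : (val u - val v : int -> M) = 0 by exact: (congr1 (fun g : int -> M => g n) E).
apply: (shifted_injective V_sa V_sum y0); first exact: rpredB (valP u) (valP v).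
move=> m; have -> : (val u - val v : int -> M) = fun n => u n + (-1) *: v n.
  by apply/funext => p; rewrite scaleN1r.
by rewrite shiftedD scaleN1r -!schrodinger_val uv subrr.
Qed.

Lemma ell2_norm_sqr (u : ell2 R L) : ell2_norm u = Num.sqrt (sqnorm u).
Proof. by []. Qed.

Lemma resolvent_is_resolvent w : complex.Im w != 0 ->
  is_resolvent V_sum w (resolvent V_sum w).
Proof.
move=> y0; apply: xgetPex.
have ex (f : ell2 R L) : exists v : ell2 R L, schrodinger V_sum v - w *: v = f.
  have [v vl2 vf] := shifted_surjective y0 (valP f).
  by exists (Ell2 vl2); apply: ell2_inj => n; rewrite schrodinger_val -vf.
have [K KE] := choice ex; exists K; split=> //; last first.
  by move=> u; apply: (schrodinger_injective y0); rewrite KE.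
split.
  move=> a u v; apply: (schrodinger_injective y0); rewrite KE.
  apply: ell2_inj => n; rewrite schrodinger_val.
  have -> : (ell2_val (a *: K u + K v)) = fun n => K v n + a *: K u n.
    by apply/funext => m; rewrite addrC.
  by rewrite shiftedD -!schrodinger_val !KE addrC.
exists `|complex.Im w|^-1 => u.
have y2 : 0 < `|complex.Im w| by rewrite normr_gt0.
rewrite mulrC ler_pdivlMr// mulrC !ell2_norm_sqr.
have sq0 (v : ell2 R L) : 0 <= sqnorm v by exact: sqnorm_ge0 (valP v).
rewrite -ler_sqr ?nnegrE ?mulr_ge0 ?sqrtr_ge0 ?(ltW y2)//.
rewrite exprMn !(sqr_sqrtr (sq0 _)) real_normK ?num_real//.
have := shifted_lower_bound V_sa V_sum y0 (valP (K u)).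
by rewrite (_ : shifted V w _ = val u)//; apply/funext => n; rewrite -schrodinger_val KE.
Qed.

End ResolventExistence.

(** * Jost solutions *)

(** The tail of the series serves as [tau]. It provides an error rate that does not depend on the
    spectral parameter. *)
Lemma summable_tail {R : realType} (f : nat -> R) (S : R) : (forall i, 0 <= f i) ->
  (forall k, \sum_(i < k) f i <= S) ->
  exists2 tau : nat -> R, tau m @[m --> \oo] --> 0 &
    forall m k, \sum_(i < k) f (m + i)%N <= tau m.
Proof.
move=> f0 fS; have nd : nondecreasing_seq (series f).
  by apply/nondecreasing_seqP => n; rewrite /series/= big_nat_recr//= lerDl.
have cf : cvgn (series f).
  by apply: nondecreasing_is_cvgn => //; exists S => _ [k _ <-]; rewrite /series/= big_mkord.
exists (fun m => lim (series f @ \oo) - series f m).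
  rewrite -(subrr (lim (series f @ \oo))); apply: cvgB => //; exact: cvg_cst.
move=> m k; rewrite lerBrDr.
have -> : \sum_(i < k) f (m + i)%N + series f m = series f (m + k)%N.
  rewrite /series/= [in RHS](big_cat_nat (n := m))//= ?leq_addr// addrC; congr (_ + _).
  rewrite -[X in _ = \sum_(X <= i < _) _]add0n big_addn addKn big_mkord.
  by apply: eq_bigr => i _; rewrite addnC.
exact: nondecreasing_cvgn_le.
Qed.

Fact lt_of_three_thirds {R : realFieldType} (x a b b' d r s e : R) : x < e / 3 -> a <= x -> b <= x ->
  d < e / 3 -> r <= a + s -> s <= d + b' -> b' = b -> r < e.
Proof. lra. Qed.

Section JostConstruction.
Context {R : realType} {L : nat} (V : int -> 'M[R[i]]_L).
Hypothesis V_sum : summable_potential V.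
Local Notation M := 'M[R[i]]_L.
Implicit Types (zeta : R[i]) (x y : M * M) (W : M).

Definition vnorm (n : int) : R := mnorm (V n).

Lemma vnorm_ge0 n : 0 <= vnorm n. Proof. exact: mnorm_ge0. Qed.

Lemma vnorm_zfin : zfin vnorm.
Proof.
have hf : zfin (fun n => hsnorm (V n)).
  split; first by move=> n; exact: hsnorm_ge0.
  by rewrite -summable_nnegP// => n; exact: hsnorm_ge0.
have [sf _] := zhasZ (exprn_ge0 2 (ler0n R L)) (zhas_zsum hf).
apply: (proj1 (zsum_le _ sf)) => n.
by rewrite mnorm_ge0/= mnorm_le_hsnorm.
Qed.

Lemma vnorm_sum_le (n : int) k : \sum_(i < k) vnorm (n + i%:Z) <= zsum vnorm.
Proof.
rewrite -(big_mkord xpredT (fun i => vnorm (n + i%:Z))).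
rewrite -(big_map (fun i : nat => n + i%:Z) xpredT vnorm).
apply: (zsum_seq_le vnorm_zfin); rewrite map_inj_uniq ?iota_uniq//.
by move=> i j /addrI [].
Qed.

(* For a solution u, put M n = zeta ^ (- n) u n and D n = M (n + 1) - M n.  Then
   Y = M + zeta (kappa zeta) D is constant when V = 0, and the pair (Y, D) obeys
   (Y, D) (n - 1) = jstep zeta (V n) ((Y, D) n), a backward recursion that is bounded
   for |zeta| <= 1 up to the factors 1 + C |V n|; amplitude recovers M. *)
Definition kappa zeta : R[i] := zeta / (zeta ^+ 2 - 1).

Definition amplitude zeta x : M := x.1 - (zeta * kappa zeta) *: x.2.

Definition jstep zeta W x : M * M :=
  (x.1 + kappa zeta *: (W *m amplitude zeta x),
   zeta ^+ 2 *: x.2 + zeta *: (W *m amplitude zeta x)).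

Definition pdist x y : R := mnorm (x.1 - y.1) + mnorm (x.2 - y.2).

Lemma pdist_ge0 x y : 0 <= pdist x y.
Proof. by rewrite addr_ge0 ?mnorm_ge0. Qed.

Section Bounds.
Variables (zeta : R[i]) (k0 : R).
Hypotheses (zeta1 : normc zeta <= 1) (kzeta : normc (kappa zeta) <= k0).
(** One factor [1 + k0] is a Lipschitz constant of [amplitude]; the other bounds [|kappa| + |zeta|],
    the total weight of the potential term in the two components of [jstep]. *)
Let C0 := (1 + k0) ^+ 2.

Lemma amplitude_dist x y :
  mnorm (amplitude zeta x - amplitude zeta y) <= (1 + k0) * pdist x y.
Proof.
have k00 : 0 <= k0 by rewrite (le_trans _ kzeta) ?normc_ge0.
have -> : amplitude zeta x - amplitude zeta y =
    (x.1 - y.1) - (zeta * kappa zeta) *: (x.2 - y.2).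
  by rewrite /amplitude scalerBr !opprD addrACA.
rewrite (le_trans (mnormB _ _))// mnormZ Normc.normcM /pdist mulrDr lerD//.
  by rewrite ler_peMl ?mnorm_ge0// lerDl.
rewrite ler_wpM2r ?mnorm_ge0// (le_trans (y := 1 * k0))//.
  by rewrite ler_pM ?normc_ge0.
by rewrite mul1r lerDr.
Qed.

Lemma jstep_dist W x y :
  pdist (jstep zeta W x) (jstep zeta W y) <= (1 + C0 * mnorm W) * pdist x y.
Proof.
have k00 : 0 <= k0 by rewrite (le_trans _ kzeta) ?normc_ge0.
set dM := W *m (amplitude zeta x - amplitude zeta y).
have dMle : mnorm dM <= mnorm W * ((1 + k0) * pdist x y).
  by rewrite (le_trans (mnormM _ _))// ler_wpM2l ?mnorm_ge0// amplitude_dist.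
have h1 : mnorm ((jstep zeta W x).1 - (jstep zeta W y).1) <=
    mnorm (x.1 - y.1) + k0 * mnorm dM.
  rewrite [X in mnorm X](_ : _ = (x.1 - y.1) + kappa zeta *: dM).
    by rewrite (le_trans (mnormD _ _))// lerD2l mnormZ ler_wpM2r ?mnorm_ge0.
  by rewrite /dM mulmxBr scalerBr /= opprD addrACA.
have h2 : mnorm ((jstep zeta W x).2 - (jstep zeta W y).2) <=
    mnorm (x.2 - y.2) + 1 * mnorm dM.
  rewrite [X in mnorm X](_ : _ = zeta ^+ 2 *: (x.2 - y.2) + zeta *: dM).
    rewrite (le_trans (mnormD _ _))// !mnormZ lerD ?ler_wpM2r ?mnorm_ge0//.
    by rewrite normcX ler_piMl ?mnorm_ge0// exprn_ile1 ?normc_ge0.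
  by rewrite /dM mulmxBr !scalerBr /= opprD addrACA.
rewrite /pdist mulrDl mul1r.
rewrite (le_trans (lerD h1 h2))// addrACA lerD2l -mulrDl.
rewrite (le_trans (ler_wpM2l _ dMle)) ?addr_ge0// /C0 /pdist.
by rewrite le_eqVlt; apply/orP; left; apply/eqP; ring.
Qed.

Lemma jstep_base W :
  pdist (jstep zeta W (1%:M, 0)) (1%:M, 0) <= C0 * mnorm W * mnorm (1%:M : M).
Proof.
have k00 : 0 <= k0 by rewrite (le_trans _ kzeta) ?normc_ge0.
rewrite /pdist /= /amplitude /= !(scaler0, subr0, add0r) (addrC 1%:M) addrK.
rewrite !mnormZ -mulrDl -mulrA ler_pM ?addr_ge0 ?normc_ge0 ?mnorm_ge0 ?mnormM//.
rewrite (le_trans (lerD kzeta zeta1))// /C0 expr2 addrC.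
by rewrite ler_peMr ?addr_ge0// lerDl.
Qed.

(* The state at n of the solution equal to zeta ^ j beyond j = n + m, i.e. for V cut
   off after n + m. *)
Fixpoint jtrunc (m : nat) (n : int) : M * M :=
  if m is m'.+1 then jstep zeta (V (n + 1)) (jtrunc m' (n + 1)) else (1%:M, 0).

(** A discrete Gronwall constant: the exponential bounds the product of all the factors
    [1 + C0 |V n|], the rest comes from [jstep_base]. *)
Definition jconst : R := expR (C0 * zsum vnorm) * C0 * mnorm (1%:M : M).

(** The two truncations differ only by the first step, where [V (n + 1 + m)] moves the free state;
    the [m] steps that follow are common and each expands distances by at most [1 + C0 |V|]. *)
Lemma jtrunc_increment m n :
  pdist (jtrunc m.+1 n) (jtrunc m n) <= jconst * vnorm (n + 1 + m%:Z).
Proof.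
have C00 : 0 <= C0 by rewrite sqr_ge0.
(* The induction keeps the sum over the sites actually crossed, so that each step contributes its
   own exponential factor; the sum is enlarged to all of the integers only afterwards. *)
apply: (@le_trans _ _ (expR (C0 * \sum_(i < m) vnorm (n + 1 + i%:Z)) *
    (C0 * vnorm (n + 1 + m%:Z) * mnorm (1%:M : M)))).
  elim: m n => [|m IHm] n.
    rewrite big_ord0 mulr0 expR0 mul1r addr0; exact: jstep_base.
  apply: le_trans (jstep_dist _ _ _) _.
  rewrite big_ord_recl addr0 [C0 * (_ + _)]mulrDr expRD -mulrA ler_pM ?pdist_ge0//.
  - by rewrite addr_ge0// mulr_ge0 ?mnorm_ge0.
  - exact: expR_ge1Dx.
  - have E i : n + 1 + 1 + i%:Z = n + 1 + (bump 0 i)%:Z.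
      by rewrite /bump/= PoszD addrA.
    rewrite (le_trans (IHm (n + 1)))// E; under eq_bigr do rewrite E.
    by [].
have -> : jconst * vnorm (n + 1 + m%:Z) = expR (C0 * zsum vnorm) *
    (C0 * vnorm (n + 1 + m%:Z) * mnorm (1%:M : M)) by rewrite /jconst; ring.
apply: ler_wpM2r; first exact: mulr_ge0 (mulr_ge0 C00 (vnorm_ge0 _)) (mnorm_ge0 _).
by rewrite ler_expR ler_wpM2l// vnorm_sum_le.
Qed.

Lemma jconst_ge0 : 0 <= jconst.
Proof. exact: mulr_ge0 (mulr_ge0 (expR_ge0 _) (sqr_ge0 _)) (mnorm_ge0 _). Qed.

End Bounds.

Definition pcvg T (F : set_system T) (f : T -> M * M) x :=
  mcvg (F := F) (fun t => (f t).1) x.1 /\ mcvg (F := F) (fun t => (f t).2) x.2.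

Section StepLimits.
Context {T : Type} {F : set_system T} {FF : Filter F}.
Variables (z : T -> R[i]) (zeta : R[i]).
Hypotheses (zeta2 : zeta ^+ 2 != 1) (zF : ccvg (F := F) z zeta).

Lemma kappa_cvg : ccvg (F := F) (fun t => kappa (z t)) (kappa zeta).
Proof.
apply: ccvgM => //; apply: ccvgV; first by rewrite subr_eq0.
by apply: ccvgD; [exact: ccvgX|apply: ccvgN; exact: ccvg_cst].
Qed.

Lemma amplitude_cvg f x : pcvg F f x ->
  mcvg (F := F) (fun t => amplitude (z t) (f t)) (amplitude zeta x).
Proof.
move=> [f1 f2]; apply: mcvgB => //; apply: mcvgZ => //.
by apply: ccvgM => //; exact: kappa_cvg.
Qed.

Lemma jstep_cvg W f x : pcvg F f x ->
  pcvg F (fun t => jstep (z t) W (f t)) (jstep zeta W x).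
Proof.
move=> fx; have [f1 f2] := fx.
have fW : mcvg (F := F) (fun t => W *m amplitude (z t) (f t)) (W *m amplitude zeta x).
  by apply: mcvgM; [exact: mcvg_cst|exact: amplitude_cvg].
split=> /=; (apply: mcvgD; last apply: mcvgZ) => //.
- exact: kappa_cvg.
- exact: mcvgZ (ccvgX 2 zF) f2.
Qed.

Lemma jtrunc_cvg m n : pcvg F (fun t => jtrunc (z t) m n) (jtrunc zeta m n).
Proof.
elim: m n => [|m IHm] n; first by split; exact: mcvg_cst.
exact: jstep_cvg.
Qed.

End StepLimits.

Definition jlim zeta n : M * M :=
  (xget 0 [set A | mcvg (F := \oo) (fun m => (jtrunc zeta m n).1) A],
   xget 0 [set A | mcvg (F := \oo) (fun m => (jtrunc zeta m n).2) A]).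

Definition jamp zeta n : M := amplitude zeta (jlim zeta n).

Definition jost zeta n : M := (zeta ^ n)%R *: jamp zeta n.

Section JostLimit.
Variables (zeta : R[i]).
Hypotheses (zeta1 : normc zeta <= 1) (zeta2 : zeta ^+ 2 != 1).

Lemma jtrunc_increment1 k0 m n : normc (kappa zeta) <= k0 ->
  mnorm ((jtrunc zeta m.+1 n).1 - (jtrunc zeta m n).1) <=
    jconst k0 * vnorm (n + 1 + m%:Z).
Proof.
move=> kk; apply: le_trans (jtrunc_increment zeta1 kk m n).
by rewrite lerDl mnorm_ge0.
Qed.

Lemma jtrunc_increment2 k0 m n : normc (kappa zeta) <= k0 ->
  mnorm ((jtrunc zeta m.+1 n).2 - (jtrunc zeta m n).2) <=
    jconst k0 * vnorm (n + 1 + m%:Z).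
Proof.
move=> kk; apply: le_trans (jtrunc_increment zeta1 kk m n).
by rewrite lerDr mnorm_ge0.
Qed.

Lemma jlim_cvg n : pcvg \oo (fun m => jtrunc zeta m n) (jlim zeta n).
Proof.
have S k : \sum_(i < k) jconst (normc (kappa zeta)) * vnorm (n + 1 + i%:Z) <=
    jconst (normc (kappa zeta)) * zsum vnorm.
  by rewrite -mulr_sumr ler_wpM2l ?jconst_ge0// vnorm_sum_le.
have [A1 h1] := mcvg_of_summable_increments
  (fun m => jtrunc_increment1 m n (lexx (normc (kappa zeta)))) S.
have [A2 h2] := mcvg_of_summable_increments
  (fun m => jtrunc_increment2 m n (lexx (normc (kappa zeta)))) S.
split=> /=.
  exact: (@xgetPex _ 0 [set A | mcvg (F := \oo) (fun m => (jtrunc zeta m n).1) A]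
    (ex_intro _ A1 h1)).
exact: (@xgetPex _ 0 [set A | mcvg (F := \oo) (fun m => (jtrunc zeta m n).2) A]
  (ex_intro _ A2 h2)).
Qed.

Lemma jlim_dist k0 m n (S : R) : normc (kappa zeta) <= k0 ->
  (forall k, \sum_(i < k) vnorm (n + 1 + (m + i)%N%:Z) <= S) ->
  pdist (jlim zeta n) (jtrunc zeta m n) <= 2 * (jconst k0 * S).
Proof.
move=> kk hS; have [c1 c2] := jlim_cvg n.
have hS' k : \sum_(i < k) jconst k0 * vnorm (n + 1 + (m + i)%N%:Z) <= jconst k0 * S.
  by rewrite -mulr_sumr ler_wpM2l ?jconst_ge0.
rewrite mulr_natl mulr2n /pdist lerD//.
  exact: (mcvg_increments_le (fun m => jtrunc_increment1 m n kk) c1 hS').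
exact: (mcvg_increments_le (fun m => jtrunc_increment2 m n kk) c2 hS').
Qed.

Lemma jlim_step n : jlim zeta n = jstep zeta (V (n + 1)) (jlim zeta (n + 1)).
Proof.
have [s1 s2] := jstep_cvg zeta2 (ccvg_cst (F := \oo) zeta) (V (n + 1)) (jlim_cvg (n + 1)).
have [c1 c2] := jlim_cvg n.
have sh (f : nat -> M) A : mcvg (F := \oo) f A -> mcvg (F := \oo) (fun m => f m.+1) A.
  by move=> fA; rewrite /mcvg (cvg_shiftS (fun m => mnorm (f m - A))).
rewrite [LHS]surjective_pairing [RHS]surjective_pairing; congr pair.
  exact: mcvg_unique (sh _ _ c1) s1.
exact: mcvg_unique (sh _ _ c2) s2.
Qed.

(** The eigenvalue equation for [zeta ^ n] times the amplitude, multiplied by [zeta ^ (1 - n)]. *)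
Lemma jamp_step n : zeta != 0 ->
  zeta ^+ 2 *: (jamp zeta (n + 1) - jamp zeta n) - (jamp zeta n - jamp zeta (n - 1)) +
  zeta *: (V n *m jamp zeta n) = 0.
Proof.
move=> z0; have z2 : zeta ^+ 2 - 1 != 0 by rewrite subr_eq0.
(* The second component of the state is indeed the forward difference of the amplitudes; this is
   what the choice of [kappa] achieves. *)
have diff m : jamp zeta (m + 1) - jamp zeta m = (jlim zeta m).2.
  rewrite {2}/jamp jlim_step /= {1}/amplitude /= -/(jamp zeta (m + 1)).
  set X := V (m + 1) *m _; rewrite /jamp /amplitude -/(jamp zeta (m + 1)).
  set Y := (jlim zeta (m + 1)).1; set D := (jlim zeta (m + 1)).2.
  apply/matrixP => i j; rewrite !mxE; move: (X i j) (Y i j) (D i j) => a b c.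
  by rewrite /kappa; field; rewrite z2.
have d2 : jamp zeta n - jamp zeta (n - 1) = (jlim zeta (n - 1)).2.
  by have := diff (n - 1); rewrite (subrK 1 n).
transitivity (zeta ^+ 2 *: (jlim zeta n).2 - (jlim zeta (n - 1)).2 +
    zeta *: (V n *m jamp zeta n)); first by congr (_ *: _ - _ + _).
have -> : (jlim zeta (n - 1)).2 = zeta ^+ 2 *: (jlim zeta n).2 + zeta *: (V n *m jamp zeta n).
  by rewrite jlim_step subrK.
by rewrite opprD addrA subrr add0r addNr.
Qed.

Lemma jost_solution : zeta != 0 -> tau V (jost zeta) = (zeta + zeta^-1) *: jost zeta.
Proof.
move=> z0; apply/funext => n.
rewrite -[RHS]/((zeta + zeta^-1) *: jost zeta n) /tau /jost.
rewrite !expfzDr// expr1z exprN1 -scalemxAr.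
move: (jamp_step n z0) (zeta ^ n)%R.
move: (V n *m jamp zeta n) => X.
move: (jamp zeta (n + 1)) (jamp zeta n) (jamp zeta (n - 1)) => a b c e w; apply/subr0_eq.
transitivity ((w * zeta^-1) *: (zeta ^+ 2 *: (a - b) - (b - c) + zeta *: X)); last first.
  by rewrite e scaler0.
apply/matrixP => i j; rewrite !mxE; move: (a i j) (b i j) (c i j) (X i j) => p q r s.
by field.
Qed.

Lemma jamp_limit : mcvg (F := \oo) (fun n : nat => jamp zeta n%:Z) 1%:M.
Proof.
have [tau tau0 htau] := summable_tail (fun i => vnorm_ge0 (0 + 1 + i%:Z)) (vnorm_sum_le (0 + 1)).
set k0 := normc (kappa zeta).
have h : tau n * ((1 + k0) * (2 * jconst k0)) @[n --> \oo] --> 0.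
  by apply: cvg0M tau0 _; exact: cvg_cst.
apply: cvg0_le h; apply: nearW => n; rewrite mnorm_ge0/=.
(* The truncation of depth 0 is the free state, of amplitude 1, so the distance to it is controlled
   by the potential beyond [n]. *)
have := amplitude_dist zeta1 (lexx k0) (jlim zeta n%:Z) (jtrunc zeta 0 n%:Z).
rewrite [X in mnorm (_ - X)]/amplitude /= scaler0 subr0 => /le_trans; apply.
rewrite mulrCA ler_wpM2l ?addr_ge0 ?normc_ge0//.
rewrite [leRHS](_ : _ = 2 * (jconst k0 * tau n)); last by ring.
apply: (@jlim_dist k0 0 n%:Z (tau n)) => // k.
apply: le_trans (htau n k); apply: ler_sum => i _.
rewrite le_eqVlt; apply/orP; left; apply/eqP; congr vnorm.
by rewrite add0r PoszD addrAC addrC addrA.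
Qed.

End JostLimit.

(** Truncations are continuous in [zeta], and [k0] bounds [kappa] near the limit point, so that the
    truncation error [tau m * c] is uniform there. The rest is an argument with three thirds of
    [e]. *)
Lemma jamp_continuous T (F : set_system T) {FF : Filter F} (z : T -> R[i]) zeta n :
  (\forall t \near F, normc (z t) <= 1) -> normc zeta <= 1 -> zeta ^+ 2 != 1 ->
  ccvg (F := F) z zeta ->
  mcvg (F := F) (fun t => jamp (z t) n) (jamp zeta n).
Proof.
move=> z1 zeta1 zeta2 zF; set k0 := normc (kappa zeta) + 1.
have k0le : normc (kappa zeta) <= k0 by rewrite lerDl.
have kF : \forall t \near F, normc (kappa (z t)) <= k0.
  have : \forall t \near F, normc (kappa (z t) - kappa zeta) < 1.
    by apply: cvg0_lt ltr01 _; exact: kappa_cvg.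
  apply: filterS => t /ltW h.
  by have := le_normcD (kappa (z t) - kappa zeta) (kappa zeta); rewrite subrK /k0; lra.
have [tau tau0 htau] := summable_tail (fun i => vnorm_ge0 (n + 1 + i%:Z)) (vnorm_sum_le (n + 1)).
pose c := (1 + k0) * (2 * jconst k0).
have h : tau n * c @[n --> \oo] --> 0 by apply: cvg0M tau0 _; exact: cvg_cst.
have close (m : nat) (y : R[i]) : normc y <= 1 -> normc (kappa y) <= k0 ->
    mnorm (jamp y n - amplitude y (jtrunc y m n)) <= tau m * c.
  move=> y1 yk; apply: le_trans (amplitude_dist y1 yk _ _) _.
  rewrite /c mulrCA ler_wpM2l ?addr_ge0 ?(le_trans _ yk) ?normc_ge0//.
  rewrite [leRHS](_ : _ = 2 * (jconst k0 * tau m)); last by ring.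
  exact: jlim_dist.
apply/cvgrPdist_lt => e e0.
have e3 : 0 < e / 3 by rewrite divr_gt0.
have [m _ /(_ m (leqnn m)) /= hm] := cvg0_lt e3 h.
have tF : \forall t \near F,
    mnorm (amplitude (z t) (jtrunc (z t) m n) - amplitude zeta (jtrunc zeta m n)) < e / 3.
  by apply: cvg0_lt e3 _; apply: amplitude_cvg => //; exact: jtrunc_cvg.
near=> t; rewrite sub0r normrN ger0_norm ?mnorm_ge0//.
have a1 : mnorm (jamp (z t) n - amplitude (z t) (jtrunc (z t) m n)) <= tau m * c.
  by apply: close; near: t.
have a2 := close m zeta zeta1 k0le.
have a3 : mnorm (amplitude (z t) (jtrunc (z t) m n) - amplitude zeta (jtrunc zeta m n)) < e / 3.
  by near: t.
have d1 := mnorm_distD (amplitude (z t) (jtrunc (z t) m n)) (jamp (z t) n) (jamp zeta n).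
have d2 := mnorm_distD (amplitude zeta (jtrunc zeta m n))
  (amplitude (z t) (jtrunc (z t) m n)) (jamp zeta n).
exact: lt_of_three_thirds hm a1 a2 a3 d1 d2 (mnorm_distC _ _).
Unshelve. all: by end_near. Qed.

End JostConstruction.

(** * Wronskians and the Green function *)

Lemma conj_expz_shiftl {R : realType} (z1 z2 : R[i]) (n : int) : z1 != 0 ->
  ((z1^* * z2) ^ (- n))%R = z1^* * (((z1 ^ (- (n + 1)))%R)^* * (z2 ^ (- n))%R).
Proof.
move=> z10; have z1c : z1^* != 0 by rewrite conjc_eq0.
rewrite [X in _ * (X * _)](_ : _ = (z1^* ^ (- (n + 1)))%R); last by apply: rmorphXz; rewrite unitfE.
by rewrite expfzMl opprD expfzDr// exprN1; move: (z1^* ^ (- n))%R (z2 ^ (- n))%R => a b; field.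
Qed.

Lemma conj_expz_shiftr {R : realType} (z1 z2 : R[i]) (n : int) : z1 != 0 -> z2 != 0 ->
  ((z1^* * z2) ^ (- n))%R = z2 * (((z1 ^ (- n))%R)^* * (z2 ^ (- (n + 1)))%R).
Proof.
move=> z10 z20.
rewrite [X in _ * (X * _)](_ : _ = (z1^* ^ (- n))%R); last by apply: rmorphXz; rewrite unitfE.
by rewrite expfzMl opprD expfzDr// exprN1; move: (z1^* ^ (- n))%R (z2 ^ (- n))%R => a b; field.
Qed.

Lemma conj_joukowski {R : rcfType} (z : R[i]) : (z^* + (z^*)^-1)^* = z + z^-1.
Proof.
rewrite rmorphD /= conjcK; congr (_ + _).
by rewrite -[in RHS](conjcK z); exact: conjc_inv.
Qed.

Section WronskianAlgebra.
Context {R : realType} {L : nat}.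
Local Notation M := 'M[R[i]]_L.
Implicit Types A B X : M.

Lemma adjZ (c : R[i]) A : (c *: A)^t* = c^* *: A^t*.
Proof. by apply/matrixP => i j; rewrite !mxE rmorphM. Qed.

Lemma adjB A B : (A - B)^t* = A^t* - B^t*.
Proof. by apply/matrixP => i j; rewrite !mxE rmorphB. Qed.

(** The Wronskian as a sesquilinear form in the values at two neighbouring sites, taken as
    independent matrices. This turns the facts about solutions into linear algebra on [2 x 2] block
    matrices. *)
Definition wform (u0 u1 v0 v1 : M) : M := 'i%C *: (u1^t* *m v0 - u0^t* *m v1).

Lemma wformE (u v : int -> M) n : wronskian_at u v n = wform (u n) (u (n + 1)) (v n) (v (n + 1)).
Proof. by []. Qed.

Lemma wform_adj u0 u1 v0 v1 : (wform u0 u1 v0 v1)^t* = wform v0 v1 u0 u1.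
Proof.
rewrite /wform adjZ adjB !adjM !adjK -[RHS]opprK -scalerN opprB -scaleNr.
by congr (_ *: _); apply/eqP; rewrite eq_complex /= oppr0 !eqxx.
Qed.

Lemma wronskian_adj (u v : int -> M) : (wronskian u v)^t* = wronskian v u.
Proof. exact: wform_adj. Qed.

Lemma wformBr u0 u1 v0 v1 w0 w1 :
  wform u0 u1 (v0 - w0) (v1 - w1) = wform u0 u1 v0 v1 - wform u0 u1 w0 w1.
Proof.
by rewrite /wform !mulmxBr -scalerBr; congr (_ *: _); rewrite !opprD addrACA.
Qed.

Lemma wformDr u0 u1 v0 v1 w0 w1 :
  wform u0 u1 (v0 + w0) (v1 + w1) = wform u0 u1 v0 v1 + wform u0 u1 w0 w1.
Proof.
by rewrite /wform !mulmxDr -scalerDr; congr (_ *: _); rewrite !opprD addrACA.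
Qed.

Lemma wformMr u0 u1 v0 v1 X :
  wform u0 u1 (v0 *m X) (v1 *m X) = wform u0 u1 v0 v1 *m X.
Proof. by rewrite /wform -scalemxAl mulmxBl !mulmxA. Qed.

Lemma wform_rescale (s c1 c2 x1 x2 y1 y2 : R[i]) (u0 u1 v0 v1 : M) :
  s = c1 * (x1^* * x2) -> s = c2 * (y1^* * y2) ->
  s *: wform u0 u1 v0 v1 =
  'i%C *: (c1 *: ((x1 *: u1)^t* *m (x2 *: v0)) - c2 *: ((y1 *: u0)^t* *m (y2 *: v1))).
Proof.
move=> e1 e2; rewrite /wform !adjZ.
move: (u1^t*) (u0^t*) => U1 U0; rewrite -!scalemxAl -!scalemxAr.
move: (U1 *m v0) (U0 *m v1) => P Q; apply/matrixP => i j; rewrite !mxE.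
by rewrite mulrCA mulrBr; congr (_ * (_ - _)); [rewrite e1|rewrite e2]; ring.
Qed.

Section Duality.
Variables (a0 a1 b0 b1 c0 c1 d0 d1 : M).
Variables A' B' : M.
Hypotheses (A'K : A' *m wform d0 d1 a0 a1 = 1%:M) (B'K : B' *m wform c0 c1 b0 b1 = 1%:M).
Hypotheses (ca0 : wform c0 c1 a0 a1 = 0) (db0 : wform d0 d1 b0 b1 = 0).

(** The hypotheses say that the second factor is a left inverse of the first: its rows compute
    Wronskians with [d] and [c], normalized by [A'] and [B']. For square matrices a left inverse is
    a right inverse, and the blocks of this second product carry the relations needed on the
    diagonal. *)
Lemma wform_dual_basis :
  block_mx a0 b0 a1 b1 *m
  block_mx (A' *m ('i%C *: d1^t*)) (- (A' *m ('i%C *: d0^t*)))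
           (B' *m ('i%C *: c1^t*)) (- (B' *m ('i%C *: c0^t*))) = 1%:M.
Proof.
apply: mulmx1C; rewrite mulmx_block.
have E (P : M) (u0 u1 v0 v1 : M) : P *m ('i%C *: u1^t*) *m v0 +
    - (P *m ('i%C *: u0^t*)) *m v1 = P *m wform u0 u1 v0 v1.
  by rewrite mulNmx -!mulmxA -mulmxBr -!scalemxAl -scalerBr.
by rewrite !E A'K B'K ca0 db0 !mulmx0 scalar_mx_block.
Qed.

(** The upper right block; it will make the kernel continuous across the diagonal. *)
Lemma wform_dual_diag : a0 *m A' *m d0^t* + b0 *m B' *m c0^t* = 0.
Proof.
have := wform_dual_basis; rewrite mulmx_block scalar_mx_block => /eq_block_mx[_ + _ _].
rewrite !mulmxN -opprD !mulmxA -!scalemxAr -scalerDr => /eqP.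
by rewrite oppr_eq0 scaler_eq0 => /orP[/eqP[/eqP]|/eqP//]; rewrite oner_eq0.
Qed.

(** The lower right block; it will produce the jump that makes a delta. *)
Lemma wform_dual_jump : a1 *m A' *m d0^t* + b1 *m B' *m c0^t* = 'i%C%:M.
Proof.
have := wform_dual_basis; rewrite mulmx_block scalar_mx_block => /eq_block_mx[_ _ _].
rewrite !mulmxN -opprD !mulmxA -!scalemxAr -scalerDr => /(congr1 (fun X => 'i%C *: X)).
rewrite scalerN scalerA -scaleNr scalemx1 => <-.
by rewrite -expr2 sqr_i opprK scale1r.
Qed.

Lemma wform_expand e0 e1 :
  e0 = a0 *m A' *m wform d0 d1 e0 e1 + b0 *m B' *m wform c0 c1 e0 e1 /\
  e1 = a1 *m A' *m wform d0 d1 e0 e1 + b1 *m B' *m wform c0 c1 e0 e1.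
Proof.
have E (P : M) (u0 u1 v0 v1 : M) : P *m ('i%C *: u1^t*) *m v0 +
    - (P *m ('i%C *: u0^t*)) *m v1 = P *m wform u0 u1 v0 v1.
  by rewrite mulNmx -!mulmxA -mulmxBr -!scalemxAl -scalerBr.
have := congr1 (mulmx^~ (col_mx e0 e1)) wform_dual_basis.
rewrite mul1mx -mulmxA mul_block_col !E mul_block_col !mulmxA => /eq_col_mx[h0 h1].
by rewrite {1}h0 {1}h1.
Qed.

Lemma wform_parseval e0 e1 f0 f1 :
  wform f0 f1 e0 e1 = wform f0 f1 a0 a1 *m (A' *m wform d0 d1 e0 e1) +
    wform f0 f1 b0 b1 *m (B' *m wform c0 c1 e0 e1).
Proof.
have [h0 h1] := wform_expand e0 e1; rewrite -!wformMr -wformDr !mulmxA.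
by congr (wform _ _ _ _).
Qed.

End Duality.

End WronskianAlgebra.

Section Asymptotics.
Context {R : realType} {L : nat} (V : int -> 'M[R[i]]_L).
Hypothesis V_sa : self_adjoint V.
Local Notation M := 'M[R[i]]_L.
Implicit Types (u v : int -> M) (zeta : R[i]).

Definition normalized_at_infinity zeta u :=
  mcvg (F := \oo) (fun n : nat => (zeta ^ (- n%:Z))%R *: u n%:Z) 1%:M.

(** Each factor is normalized by its own power, one at [n] and one at [n + 1], which leaves the
    factors [conj z1] and [z2]. The variable [w1] allows [conj z1] to be given in simplified form
    when [z1] is itself a conjugate. *)
Lemma wronskian_at_limit z1 w1 z2 u v : w1 = z1^* -> z1 != 0 -> z2 != 0 ->
  normalized_at_infinity z1 u -> normalized_at_infinity z2 v ->
  mcvg (F := \oo) (fun n : nat => ((w1 * z2) ^ (- n%:Z))%R *: wronskian_at u v n%:Z)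
    ('i%C * (w1 - z2))%:M.
Proof.
move=> w1E z10 z20 u1 v1.
have sh z w : normalized_at_infinity z w ->
    mcvg (F := \oo) (fun n : nat => (z ^ (- (n%:Z + 1)))%R *: w (n%:Z + 1)) 1%:M.
  move=> wl; pose g (n : nat) := mnorm ((z ^ (- n%:Z))%R *: w n%:Z - 1%:M).
  have gS : g n.+1 @[n --> \oo] --> 0 by rewrite (cvg_shiftS g); exact: wl.
  apply: cvg0_le gS; apply: nearW => n; rewrite mnorm_ge0 /=.
  have -> : n%:Z + 1 = n.+1%:Z by rewrite -addn1 PoszD.
  exact: lexx.
have := sh _ _ u1; have := sh _ _ v1; move=> v1' u1'.
have -> : (fun n : nat => ((w1 * z2) ^ (- n%:Z))%R *: wronskian_at u v n%:Z) =
  fun n : nat => 'i%C *: (w1 *: (((z1 ^ (- (n%:Z + 1)))%R *: u (n%:Z + 1))^t* *m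
      ((z2 ^ (- n%:Z))%R *: v n%:Z)) -
    z2 *: (((z1 ^ (- n%:Z))%R *: u n%:Z)^t* *m ((z2 ^ (- (n%:Z + 1)))%R *: v (n%:Z + 1)))).
  apply/funext => n; apply: wform_rescale.
    by rewrite w1E; exact: conj_expz_shiftl.
  by rewrite w1E; exact: conj_expz_shiftr.
have -> : ('i%C * (w1 - z2))%:M =
    'i%C *: (w1 *: ((1%:M : M)^t* *m 1%:M) - z2 *: ((1%:M : M)^t* *m 1%:M)).
  have -> : (1%:M : M)^t* = 1%:M.
    by apply/matrixP => i j; rewrite adjE !mxE eq_sym; case: eqP => _; rewrite ?conjc1 ?conjc0.
  by rewrite mulmx1 -scalerBl scalerA scalemx1.
apply: mcvgZ; first exact: ccvg_cst.
apply: mcvgB; (apply: mcvgZ; first exact: ccvg_cst).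
  exact: mcvgM (mcvg_adj u1') v1.
exact: mcvgM (mcvg_adj u1) v1'.
Qed.

(** The constant Wronskian multiplied by [zeta ^ (- 2 n)] tends to [i (zeta - zeta) = 0], and this
    factor has modulus at least 1. No decay is used, so the unit circle is covered. *)
Lemma wronskian_decaying zeta u v : zeta != 0 -> normc zeta <= 1 ->
  normalized_at_infinity zeta^* u -> normalized_at_infinity zeta v ->
  tau V u = (zeta^* + zeta^* ^-1) *: u -> tau V v = (zeta + zeta^-1) *: v ->
  forall n, wronskian_at u v n = 0.
Proof.
move=> z0 z1 u1 v1 tu tv.
have wc n : wronskian_at u v n = wronskian u v.
  by apply: wronskian_const V_sa tu _ n; rewrite tv; congr (_ *: _); exact/esym/conj_joukowski.
have zc0 : zeta^* != 0 by rewrite conjc_eq0.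
have := wronskian_at_limit (esym (conjcK zeta)) zc0 z0 u1 v1; rewrite subrr mulr0 => lim.
move=> n; rewrite wc; apply: (mcvg_unique (F := \oo) (mcvg_cst _)).
apply: cvg0_le lim; apply: nearW => m; rewrite mnorm_ge0 /= wc.
have z0M : (0%:M : M) = 0 by exact: raddf0.
rewrite z0M !subr0 [leRHS]mnormZ ler_peMl ?mnorm_ge0// normcXz Normc.normcM.
rewrite -exprz_inv -exprnP exprn_ege1// invf_ge1; last by rewrite mulr_gt0 ?normc_gt0.
by rewrite mulr_ile1 ?normc_ge0.
Qed.

End Asymptotics.

Section ExponentialDecay.
Context {R : realType}.

Lemma sum_subset_le (I : eqType) (s t : seq I) (f : I -> R) : (forall x, 0 <= f x) ->
  uniq s -> uniq t -> {subset s <= t} -> \sum_(x <- s) f x <= \sum_(x <- t) f x.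
Proof.
move=> f0 us ut st; rewrite [leRHS](bigID [in s])/= -[X in _ <= X + _]big_filter.
have ts : perm_eq [seq x <- t | x \in s] s.
  by apply: uniq_perm => [||x]; rewrite ?filter_uniq// mem_filter andb_idr//; exact: st.
by rewrite (perm_big _ ts) lerDl sumr_ge0.
Qed.

Lemma uniq_geometric_sum_le (q : R) (s : seq nat) : 0 <= q < 1 -> uniq s ->
  \sum_(m <- s) q ^+ m <= (1 - q)^-1.
Proof.
move=> q01 us; have [q0 _] := andP q01.
apply: le_trans (geometric_sum_le (\max_(x <- s) x).+1 q01).
rewrite -(big_mkord xpredT (fun i => q ^+ i)).
apply: sum_subset_le => //; [by move=> x; exact: exprn_ge0|exact: iota_uniq|].
by move=> x xs; rewrite mem_index_iota ltnS (leq_bigmax_seq _ xs).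
Qed.

Lemma zfin_exponential_decay (f : int -> R) (C q : R) (N : nat) : (forall n, 0 <= f n) ->
  0 <= C -> 0 <= q < 1 ->
  (forall n, (N <= `|n|)%N -> f n <= C * q ^+ `|n|%N) -> zfin f.
Proof.
move=> f0 C0 q01 fC; have [q0 _] := andP q01.
(* The integers from [- N] to [N - 1], among them all those with [|n| < N]. *)
pose t := [seq i%:Z - N%:Z | i <- iota 0 (N + N)].
apply: (proj1 (@zfin_le_seqP _ _ (\sum_(n <- t) f n + C * ((1 - q)^-1 + (1 - q)^-1)) f0 _)).
move=> s us; rewrite (bigID (fun n : int => (N <= `|n|)%N))/= addrC lerD//.
  rewrite -big_filter; apply: sum_subset_le => //; first exact: filter_uniq.
    by rewrite map_inj_uniq ?iota_uniq// => i j /addIr [].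
  move=> n; rewrite mem_filter -ltnNge => /andP[nN _]; apply/mapP.
  by exists (absz (n + N%:Z)%R); rewrite ?mem_iota; lia.
apply: (@le_trans _ _ (\sum_(n <- s) C * q ^+ `|n|%N)).
  rewrite big_mkcond; apply: ler_sum => n _; case: ifP => [/fC//|_].
  by rewrite mulr_ge0// exprn_ge0.
rewrite -mulr_sumr ler_wpM2l// (bigID (fun n : int => 0 <= n))/= lerD//.
  rewrite -big_filter -(big_map absz xpredT (fun m => q ^+ m)).
  apply: uniq_geometric_sum_le => //; rewrite map_inj_in_uniq ?filter_uniq//.
  by move=> x y; rewrite !mem_filter => /andP[x0 _] /andP[y0 _]; lia.
rewrite -big_filter -(big_map absz xpredT (fun m => q ^+ m)).
apply: uniq_geometric_sum_le => //; rewrite map_inj_in_uniq ?filter_uniq//.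
by move=> x y; rewrite !mem_filter => /andP[x0 _] /andP[y0 _]; lia.
Qed.

End ExponentialDecay.

(** Reflection exchanges the two ends of the line and reduces solutions normalized at [-oo] to those
    at [+oo]. *)
Definition refl {T} (u : int -> T) (n : int) : T := u (- n).

Lemma reflK T (u : int -> T) : refl (refl u) = u.
Proof. by apply/funext => n; rewrite /refl opprK. Qed.

Section Reflection.
Context {R : realType} {L : nat}.
Local Notation M := 'M[R[i]]_L.
Implicit Types (V u v : int -> M).

Lemma tau_refl V u n : tau (refl V) (refl u) n = tau V u (- n).
Proof. by rewrite /tau /refl !opprD opprK; congr (_ + _); rewrite addrC. Qed.

(** The bond from [n] to [n + 1] is carried to the one from [- n - 1] to [- n] with reversed
    orientation, hence the sign. *)
Lemma wronskian_at_refl u v n :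
  wronskian_at (refl u) (refl v) n = - wronskian_at u v (- n - 1).
Proof. by rewrite /wronskian_at /refl subrK opprD -scalerN opprB. Qed.

Lemma self_adjoint_refl V : self_adjoint V -> self_adjoint (refl V).
Proof. by move=> Vsa n; exact: Vsa. Qed.

Lemma summable_potential_refl V : summable_potential V -> summable_potential (refl V).
Proof.
move=> h; have {}h : (\esum_(n in setT) (hsnorm (V n))%:E < +oo)%E.
  by rewrite -summable_nnegP// => n; exact: hsnorm_ge0.
have opp_bij : set_bij setT setT (fun n : int => - n).
  by split.
rewrite (reindex_esum _ _ _ (fun n => (hsnorm (V n))%:E) opp_bij) -summable_nnegP in h => //.
by move=> n; exact: hsnorm_ge0.
Qed.

End Reflection.

Section Boundary.
Context {R : realType} {L : nat}.
Local Notation M := 'M[R[i]]_L.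
Implicit Types (V a p q u v : int -> M) (z : R[i]).

Definition jost_at V z u :=
  tau V u = (z + z^-1) *: u /\ normalized_at_infinity z u.

Lemma unimodular_conj z : normc z = 1 -> z^* * z = 1.
Proof.
case: z => x y /= h; have : x ^+ 2 + y ^+ 2 = 1.
  by rewrite -(sqr_sqrtr (addr_ge0 (sqr_ge0 x) (sqr_ge0 y))) h expr1n.
by move=> e; apply/eqP; rewrite eq_complex /= -e; apply/andP; split; apply/eqP; ring.
Qed.

Definition wronskian_value z : R[i] := 'i%C * (z^* - z).

Lemma wronskian_jost_eq0 V z u v n : self_adjoint V -> z != 0 -> normc z <= 1 ->
  jost_at V z^* u -> jost_at V z v -> wronskian_at u v n = 0.
Proof. by move=> Vsa z0 z1 [tu lu] [tv lv]; exact: (wronskian_decaying Vsa z0 z1 lu lv tu tv). Qed.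

Lemma wronskian_jost_unimodular V z u v n : self_adjoint V -> normc z = 1 ->
  jost_at V z u -> jost_at V z v -> wronskian_at u v n = (wronskian_value z)%:M.
Proof.
move=> Vsa z1 [tu lu] [tv lv].
have z0 : z != 0 by rewrite -normc_gt0 z1.
have zz := unimodular_conj z1.
have zV : z^* = z^-1 by rewrite -[LHS](mulfK z0) zz mul1r.
have wc m : wronskian_at u v m = wronskian u v.
  apply: wronskian_const Vsa tu _ m; rewrite tv; congr (_ *: _).
  rewrite -[in LHS]zV addrC -[in RHS]zV rmorphD /=; congr (_ + _); exact/esym/conjcK.
rewrite wc; apply: (mcvg_unique (F := \oo) (mcvg_cst _)).
apply: cvg0_le (wronskian_at_limit erefl z0 z0 lu lv); apply: nearW => m.
by rewrite mnorm_ge0 /= zz exp1rz scale1r wc lexx.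
Qed.

(** Expanded in the basis [v], [q], the difference [u - v] has coefficients given by its Wronskians
    with [v] and [q], and both vanish because those of [u] and [v] agree. Dividing by the
    self-Wronskians requires the value to be nonzero. *)
Lemma jost_unimodular_unique V z q u v : self_adjoint V -> normc z = 1 ->
  wronskian_value z != 0 -> jost_at V z^* q -> jost_at V z u -> jost_at V z v -> u = v.
Proof.
move=> Vsa z1 c0 jq ju jv; apply/funext => n.
have z0 : z != 0 by rewrite -normc_gt0 z1.
have z1le : normc z <= 1 by rewrite z1.
have zc1 : normc z^* = 1 by rewrite normc_conj.
have cc : wronskian_value z^* = - wronskian_value z.
  by rewrite /wronskian_value -mulrN opprB; congr (_ * (_ - _)); exact: conjcK.
have wvv := wronskian_jost_unimodular n Vsa z1 jv jv.
have wvu := wronskian_jost_unimodular n Vsa z1 jv ju.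
have wqq := wronskian_jost_unimodular n Vsa zc1 jq jq.
have wqu := wronskian_jost_eq0 n Vsa z0 z1le jq ju.
have wqv := wronskian_jost_eq0 n Vsa z0 z1le jq jv.
have wvq : wronskian_at v q n = 0 by rewrite wformE -wform_adj -wformE wqv linear0 map_mx0.
rewrite cc in wqq; move: c0 wvv wvu wqq wqu wqv wvq; rewrite !wformE.
move: (wronskian_value z) (u n) (u (n + 1)) (v n) (v (n + 1)) (q n) (q (n + 1)).
move=> c u0 u1 v0 v1 q0 q1 c0 wvv wvu wqq wqu wqv wvq.
apply/subr0_eq.
have A'K : c^-1%:M *m wform v0 v1 v0 v1 = 1%:M by rewrite wvv -scalar_mxM mulVf.
have B'K : (- c)^-1%:M *m wform q0 q1 q0 q1 = 1%:M.
  by rewrite wqq -scalar_mxM mulVf// oppr_eq0.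
have [-> _] := wform_expand A'K B'K wqv wvq (u0 - v0) (u1 - v1).
by rewrite !wformBr wvv wvu wqu wqv !subrr !mulmx0 addr0.
Qed.

End Boundary.

Section WronskianInvertible.
Context {R : realType} {L : nat}.
Local Notation M := 'M[R[i]]_L.
Implicit Types (V a u v : int -> M) (z : R[i]).

Lemma wronskian_valueE z : wronskian_value z = (2 * complex.Im z)%:C.
Proof. by case: z => x y; apply/eqP; rewrite eq_complex /=; apply/andP; split; apply/eqP; ring. Qed.

Lemma Re_hsdot (A : M) : complex.Re (\tr (A^t* *m A)) = hsnorm A ^+ 2.
Proof. by rewrite -[\tr _]/(hsdot A A) hsdotE hsnorm_sqr. Qed.

Lemma Re_mxtraceZ (A : M) (x : R[i]) (d : R) :
  x = d%:C -> complex.Re (\tr (x *: (A^t* *m A))) = d * hsnorm A ^+ 2.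
Proof.
move=> ->; rewrite -Re_hsdot mxtraceZ.
by case: (\tr (A^t* *m A)) => x1 x2 /=; rewrite mul0r subr0.
Qed.

Fact nonpos_of_opposite (c x y : R) : c != 0 -> 0 <= y -> c * x = - c^-1 * y -> x <= 0.
Proof.
move=> c0 y0 e; have c2 : 0 < c ^+ 2 by rewrite lt_neqAle eq_sym sqrf_eq0 c0 sqr_ge0.
by rewrite -(pmulr_rle0 _ c2) expr2 -mulrA e mulNr mulrN oppr_le0 mulVKf.
Qed.

Lemma indefinite_form_kernel (A B X : M) (c d e : R[i]) :
  A^t* *m (e%:M *m A) + B^t* *m (d%:M *m B) = c%:M -> A *m X = 0 ->
  c *: (X^t* *m X) = d *: ((B *m X)^t* *m (B *m X)).
Proof.
move=> E AX; have e1 : c%:M *m X = B^t* *m (d *: (B *m X)).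
  by rewrite -E mulmxDl -!mulmxA AX !mulmx0 add0r mul_scalar_mx.
rewrite [LHS]scalemxAr -mul_scalar_mx e1 mulmxA -adjM.
exact/esym/scalemxAr.
Qed.

(** A kernel element [X] of [A] would satisfy [c |X|^2 = - |B X|^2 / c], with opposite signs on the
    two sides. *)
Lemma unitmx_of_indefinite_form (A A' B B' S : M) (c : R) : c != 0 ->
  A^t* = A' -> B^t* = B' ->
  S = A' *m (c%:C^-1%:M *m A) + B' *m ((- c%:C)^-1%:M *m B) -> S = c%:C%:M ->
  A \in unitmx.
Proof.
move=> c0 <- <- -> E; suff : cokermx A = 0 by move=> /eqP; rewrite cokermx_eq0 row_full_unit.
set X := cokermx A; have AX : A *m X = 0 by exact: mulmx_coker.
have h := indefinite_form_kernel E AX.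
have dE : (- c%:C)^-1 = (- c^-1)%:C :> R[i] by rewrite invrN rmorphN fmorphV.
have e := etrans (esym (Re_mxtraceZ X (erefl c%:C)))
  (etrans (congr1 (fun T => complex.Re (\tr T)) h) (Re_mxtraceZ (B *m X) dE)).
by apply: hsnorm_eq0; exact: nonpos_of_opposite c0 (sqr_ge0 _) e.
Qed.

Lemma scalar_mxN (c : R[i]) : (- c)%:M = - c%:M :> M.
Proof. by apply/matrixP => i j; rewrite !mxE mulNrn. Qed.

(** Here [refl P] and [refl Q] are the solutions [u_-] at [z] and at [1/z], whose self-Wronskians
    are [r] and [- r]. The expansion of [W(a, a) = r] in this basis is the indefinite form above,
    with [A] the Wronskian in question. *)
Lemma wronskian_unit V z a (P Q : int -> M) : self_adjoint V -> normc z = 1 ->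
  complex.Im z != 0 -> jost_at V z a -> jost_at (refl V) z^* P -> jost_at (refl V) z Q ->
  wronskian (refl P) a \in unitmx.
Proof.
move=> Vsa z1 y0 ja jP jQ; have rVsa := self_adjoint_refl Vsa.
have z0 : z != 0 by rewrite -normc_gt0 z1.
have z1le : normc z <= 1 by rewrite z1.
have zc1 : normc z^* = 1 by rewrite normc_conj.
pose r : R := 2 * complex.Im z; have r0 : r != 0 by rewrite mulf_neq0// pnatr_eq0.
have cE : wronskian_value z = r%:C by exact: wronskian_valueE.
have ccE : wronskian_value z^* = - r%:C.
  by rewrite wronskian_valueE /r; case: (z) => x y /=; rewrite -rmorphN mulrN.
have waa := wronskian_jost_unimodular 0 Vsa z1 ja ja.
have wPP := wronskian_jost_unimodular (- 0 - 1) rVsa zc1 jP jP.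
have wQQ := wronskian_jost_unimodular (- 0 - 1) rVsa z1 jQ jQ.
have wPQ := wronskian_jost_eq0 (- 0 - 1) rVsa z0 z1le jP jQ.
have wpp : wronskian_at (refl P) (refl P) 0 = r%:C%:M.
  by rewrite wronskian_at_refl wPP ccE scalar_mxN opprK.
have wqq : wronskian_at (refl Q) (refl Q) 0 = (- r%:C)%:M.
  by rewrite wronskian_at_refl wQQ cE -scalar_mxN.
have wpq : wronskian_at (refl P) (refl Q) 0 = 0 by rewrite wronskian_at_refl wPQ oppr0.
have wqp : wronskian_at (refl Q) (refl P) 0 = 0.
  by rewrite wformE -wform_adj -wformE wpq linear0 map_mx0.
rewrite cE in waa; rewrite /wronskian; move: waa wpp wqq wpq wqp; rewrite !wformE.
move: (a 0) (a (0 + 1)) (refl P 0) (refl P (0 + 1)) (refl Q 0) (refl Q (0 + 1)).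
move=> a0 a1 p0 p1 q0 q1 waa wpp wqq wpq wqp.
have c0 : r%:C != 0 :> R[i] by rewrite fmorph_eq0.
have A'K : r%:C^-1%:M *m wform p0 p1 p0 p1 = 1%:M by rewrite wpp -scalar_mxM mulVf.
have B'K : (- r%:C)^-1%:M *m wform q0 q1 q0 q1 = 1%:M.
  by rewrite wqq -scalar_mxM mulVf// oppr_eq0.
exact: (unitmx_of_indefinite_form r0 (wform_adj p0 p1 a0 a1) (wform_adj q0 q1 a0 a1)
  (wform_parseval A'K B'K wqp wpq a0 a1 a0 a1) waa).
Qed.

End WronskianInvertible.

Fact large_nonneg_index (Na Nb : nat) (r n : int) :
  ((maxn (maxn Na Nb) `|r|).+1 <= `|n|)%N -> 0 <= n ->
  [/\ r <= n, `|n|%N%:Z = n & (Na <= `|n|)%N].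
Proof. by move=> hn n0; split; lia. Qed.

Fact large_neg_index (Na Nb : nat) (r n : int) :
  ((maxn (maxn Na Nb) `|r|).+1 <= `|n|)%N -> n < 0 ->
  [/\ n < r, `|n|%N%:Z = - n & (Nb <= `|n|)%N].
Proof. by move=> hn n0; split; lia. Qed.

Lemma normc_i {R : rcfType} : normc ('i%C : R[i]) = 1.
Proof. by rewrite /= expr0n expr1n add0r sqrtr1. Qed.

(** * The Green function at nonreal energies *)

Section GreenFunction.
Context {R : realType} {L : nat} (V : int -> 'M[R[i]]_L).
Hypotheses (V_sa : self_adjoint V) (V_sum : summable_potential V).
Local Notation M := 'M[R[i]]_L.
Implicit Types u v : int -> M.

(** [a] and [b] are meant to solve the equation at energy [w] and to decay at [+oo] and at [-oo];
    [a'] and [b'] are their counterparts at the conjugate energy. *)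
Definition green (a a' b b' : int -> M) (r s : int) : M :=
  if r <= s then (- 'i%C) *: (a s *m invmx (wronskian b' a) *m (b' r)^t*)
  else 'i%C *: (b s *m invmx (wronskian a' b) *m (a' r)^t*).

Lemma shifted_mulr w (c : R[i]) u (K : M) n :
  shifted V w u n = 0 -> shifted V w (fun m => c *: (u m *m K)) n = 0.
Proof.
move=> u0; transitivity (c *: (shifted V w u n *m K)); last by rewrite u0 mul0mx scaler0.
rewrite /shifted /tau mulmxBl !mulmxDl -!scalemxAl -!scalemxAr mulmxA.
move: (u (n + 1) *m K) (u (n - 1) *m K) (V n *m u n *m K) (u n *m K) => A B C D.
by apply/matrixP => i j; rewrite !mxE; ring.
Qed.

Lemma shifted_mulmx w u (K : M) n :
  shifted V w (fun m => u m *m K) n = shifted V w u n *m K.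
Proof. by rewrite /shifted /tau mulmxBl !mulmxDl -scalemxAl mulmxA. Qed.

Lemma shifted_ext w u v n : u (n + 1) = v (n + 1) -> u n = v n -> u (n - 1) = v (n - 1) ->
  shifted V w u n = shifted V w v n.
Proof. by rewrite /shifted /tau => -> -> ->. Qed.

Lemma shifted_ext_jump w u v n (D : M) : u (n + 1) = v (n + 1) + D -> u n = v n ->
  u (n - 1) = v (n - 1) -> shifted V w u n = shifted V w v n + D.
Proof.
rewrite /shifted /tau => -> -> ->; move: (v (n + 1)) (v (n - 1)) (V n *m v n) (w *: v n).
by move=> X Y Z T; apply/matrixP => i j; rewrite !mxE; ring.
Qed.

Lemma normalized_decay z u : z != 0 -> normalized_at_infinity z u ->
  exists C : R, exists N : nat, 0 <= C /\
    forall n : nat, (N <= n)%N -> mnorm (u n%:Z) <= C * normc z ^+ n.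
Proof.
move=> z0 lu; have [N _ hN] := cvg0_lt ltr01 lu.
exists (1 + mnorm (1%:M : M)), N; split; first by rewrite addr_ge0 ?mnorm_ge0.
move=> n Nn; have {hN} := hN n Nn; set x := (z ^ (- n%:Z))%R *: u n%:Z => hx.
have -> : u n%:Z = z ^+ n *: x.
  by rewrite /x scalerA -exprnN mulfV ?scale1r// expf_neq0.
rewrite mnormZ normcX mulrC ler_wpM2r ?exprn_ge0 ?normc_ge0//.
by have := mnormD (x - 1%:M) 1%:M; rewrite subrK => /le_trans; apply; rewrite lerD2r ltW.
Qed.

Lemma l2_exponential_decay u (C q : R) (N : nat) : 0 <= C -> 0 <= q < 1 ->
  (forall n, (N <= `|n|)%N -> mnorm (u n) <= C * q ^+ `|n|%N) -> u \in l2_pred.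
Proof.
move=> C0 /andP[q0 q1] uC; apply/l2_zfin.
have q01 : 0 <= q ^+ 2 < 1 by rewrite exprn_ge0//= expr_lt1.
apply: (zfin_exponential_decay (fun n => sqr_ge0 _) (sqr_ge0 C) q01 (N := N)) => n hn.
rewrite exprAC -exprMn; apply: lerXn2r; rewrite ?nnegrE.
- exact: hsnorm_ge0.
- exact: mulr_ge0 C0 (exprn_ge0 _ q0).
- exact: le_trans (hsnorm_le_mnorm _) (uC n hn).
Qed.

Section Column.
Variables (z : R[i]) (a a' P P' : int -> M).
Hypotheses (z0 : z != 0) (z1 : normc z <= 1).
Hypotheses (ja : jost_at V z a) (ja' : jost_at V z^* a').
Hypotheses (jP : jost_at (refl V) z P) (jP' : jost_at (refl V) z^* P').
Let b := refl P.
Let b' := refl P'.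
Hypotheses (uA : wronskian b' a \in unitmx) (uB : wronskian a' b \in unitmx).
Let w := z + z^-1.

Lemma shifted_jost u : tau V u = w *: u -> forall n, shifted V w u n = 0.
Proof. by move=> tu n; rewrite /shifted tu subrr. Qed.

Lemma tau_refl_jost (y : R[i]) (Q : int -> M) : jost_at (refl V) y Q ->
  tau V (refl Q) = (y + y^-1) *: refl Q.
Proof. by move=> [tQ _]; apply/funext => n; rewrite -[V in LHS]reflK tau_refl tQ. Qed.

Lemma wronskian_conj_const (u v : int -> M) n :
  tau V u = (z^* + (z^*)^-1) *: u -> tau V v = w *: v ->
  wronskian_at u v n = wronskian u v.
Proof.
move=> tu tv; apply: wronskian_const V_sa tu _ n; rewrite tv; congr (_ *: _).
exact/esym/conj_joukowski.
Qed.

Lemma green_relations r :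
  a r *m invmx (wronskian b' a) *m (b' r)^t* +
    b r *m invmx (wronskian a' b) *m (a' r)^t* = 0 /\
  a (r + 1) *m invmx (wronskian b' a) *m (b' r)^t* +
    b (r + 1) *m invmx (wronskian a' b) *m (a' r)^t* = 'i%C%:M.
Proof.
have tb' := tau_refl_jost jP'; have tb := tau_refl_jost jP.
have A'K : invmx (wronskian b' a) *m wronskian_at b' a r = 1%:M.
  by rewrite (wronskian_conj_const r tb' (proj1 ja)) mulVmx.
have B'K : invmx (wronskian a' b) *m wronskian_at a' b r = 1%:M.
  by rewrite (wronskian_conj_const r (proj1 ja') tb) mulVmx.
have ca0 : wronskian_at a' a r = 0 := wronskian_jost_eq0 r V_sa z0 z1 ja' ja.
have db0 : wronskian_at b' b r = 0.
  rewrite wronskian_at_refl.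
  by rewrite (wronskian_jost_eq0 _ (self_adjoint_refl V_sa) z0 z1 jP' jP) oppr0.
split; [exact: wform_dual_diag A'K B'K ca0 db0|exact: wform_dual_jump A'K B'K ca0 db0].
Qed.

(** The two branches of the kernel, each continued to all [s], where it solves the homogeneous
    equation. *)
Let gplus r (s : int) : M := (- 'i%C) *: (a s *m (invmx (wronskian b' a) *m (b' r)^t*)).
Let gminus r (s : int) : M := 'i%C *: (b s *m (invmx (wronskian a' b) *m (a' r)^t*)).

Lemma green_diag r : gplus r r = gminus r r.
Proof.
have [h _] := green_relations r; rewrite /gplus /gminus !mulmxA scaleNr.
by apply/eqP; rewrite -subr_eq0 -opprD -scalerDr h scaler0 oppr0.
Qed.

Lemma green_jump r : gplus r (r + 1) = gminus r (r + 1) + 1%:M.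
Proof.
have [_ h] := green_relations r; rewrite /gplus /gminus !mulmxA scaleNr.
move: h; set X := _ *m _ *m (b' r)^t*; set Y := _ *m _ *m (a' r)^t* => h.
rewrite (_ : X = 'i%C%:M - Y); last by rewrite -h addrK.
rewrite scalerBr opprB; congr (_ + _).
by rewrite scale_scalar_mx -expr2 sqr_i -scalar_mxN opprK.
Qed.

Lemma green_ge r s : r <= s -> green a a' b b' r s = gplus r s.
Proof. by rewrite /green => ->; rewrite /gplus mulmxA. Qed.

Lemma green_lt r s : s < r -> green a a' b b' r s = gminus r s.
Proof. by rewrite ltNge /green => /negPf ->; rewrite /gminus mulmxA. Qed.

Lemma green_le r s : s <= r -> green a a' b b' r s = gminus r s.
Proof.
move=> sr; have [->|ne] := eqVneq s r; first by rewrite green_ge ?green_diag.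
by apply: green_lt; rewrite lt_neqAle ne.
Qed.

(** The diagonal belongs to both branches, so at [n <> r] the three sites involved lie in a single
    one. At [n = r] only the site [r + 1] departs from [gminus], by the jump. *)
Lemma shifted_green r n : shifted V w (green a a' b b' r) n = if n == r then 1%:M else 0.
Proof.
have sp : shifted V w (gplus r) n = 0.
  by apply: shifted_mulr; exact: shifted_jost (proj1 ja) n.
have sm : shifted V w (gminus r) n = 0.
  by apply: shifted_mulr; exact: shifted_jost (tau_refl_jost jP) n.
case: (ltgtP n r) => [nr|rn|nr].
- by rewrite -sm; apply: shifted_ext; apply: green_le; lia.
- by rewrite -sp; apply: shifted_ext; apply: green_ge; lia.
- rewrite -[RHS]add0r -sm nr; apply: shifted_ext_jump; [|apply: green_le; lia..].
  by rewrite green_ge ?green_jump//; lia.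
Qed.

Lemma green_l2 r (A : M) : normc z < 1 -> (fun s => green a a' b b' r s *m A) \in l2_pred.
Proof.
move=> zlt1; have [Ca [Na [Ca0 ha]]] := normalized_decay z0 (proj2 ja).
have [Cb [Nb [Cb0 hb]]] := normalized_decay z0 (proj2 jP).
have q01 : 0 <= normc z < 1 by rewrite normc_ge0.
have [K1 [K10 hp]] : exists K1 : R, 0 <= K1 /\ forall s, mnorm (gplus r s) <= mnorm (a s) * K1.
  exists (mnorm (invmx (wronskian b' a) *m (b' r)^t*)); split; first exact: mnorm_ge0.
  by move=> s; rewrite /gplus mnormZ normcN normc_i mul1r; exact: mnormM.
have [K2 [K20 hm]] : exists K2 : R, 0 <= K2 /\ forall s, mnorm (gminus r s) <= mnorm (b s) * K2.
  exists (mnorm (invmx (wronskian a' b) *m (a' r)^t*)); split; first exact: mnorm_ge0.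
  by move=> s; rewrite /gminus mnormZ normc_i mul1r; exact: mnormM.
have A0 := mnorm_ge0 A.
have C0 : 0 <= (Ca * K1 + Cb * K2) * mnorm A.
  exact: mulr_ge0 (addr_ge0 (mulr_ge0 Ca0 K10) (mulr_ge0 Cb0 K20)) A0.
(* Beyond this index the sign of [n] decides on which side of [r] it lies, and the decay estimate at
   the corresponding end applies. *)
apply: (l2_exponential_decay (N := (maxn (maxn Na Nb) `|r|%N).+1) C0 q01) => n hn.
have zn0 : 0 <= normc z ^+ `|n| by apply: exprn_ge0; exact: normc_ge0.
apply: le_trans (mnormM _ _) _; rewrite mulrAC; apply: (ler_wpM2r A0).
have [n0|n0] := leP 0 n.
  have [rn nE nN] := large_nonneg_index hn n0.
  rewrite (green_ge rn); apply: le_trans (hp n) _.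
  have := ha _ nN; rewrite nE => /(ler_wpM2r K10) h; apply: le_trans h _.
  by rewrite mulrAC; apply: (ler_wpM2r zn0); rewrite lerDl; exact: mulr_ge0.
have [rn nE nN] := large_neg_index hn n0.
rewrite (green_lt rn); apply: le_trans (hm n) _.
have := hb _ nN; rewrite nE => /(ler_wpM2r K20) h; apply: le_trans h _.
by rewrite mulrAC; apply: (ler_wpM2r zn0); rewrite lerDr; exact: mulr_ge0.
Qed.

Lemma matrix_element_green r s (A : M) : normc z < 1 -> complex.Im w != 0 ->
  matrix_element (resolvent V_sum w) s r A = green a a' b b' r s *m A.
Proof.
move=> zlt1 y0; have [_ _ KL] := resolvent_is_resolvent V_sa V_sum y0.
have KG := KL (Ell2 (green_l2 r A zlt1)).
rewrite /matrix_element /ell2_proj -[RHS]/(Ell2 (green_l2 r A zlt1) s) -[in RHS]KG.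
congr (ell2_val (_ _) s); apply: ell2_inj => n; rewrite schrodinger_val.
transitivity (shifted V w (green a a' b b' r) n *m A).
  by rewrite shifted_green /=; case: eqP => _; rewrite ?mul1mx ?mul0mx.
by rewrite -shifted_mulmx.
Qed.

End Column.
End GreenFunction.

(** * Boundary values *)

Section JostIdentification.
Context {R : realType} {L : nat}.
Local Notation M := 'M[R[i]]_L.
Implicit Types (V u : int -> M) (z : R[i]).

Lemma unimodular_sqr_neq1 z : normc z = 1 -> complex.Im z != 0 -> z ^+ 2 != 1.
Proof.
move=> z1 y0; apply: contra_neq y0 => z2.
have z0 : z != 0 by rewrite -normc_gt0 z1.
have e : z^* = z by apply: (mulIf z0); rewrite unimodular_conj// -expr2 z2.
by move: e; case: z {z1 z2 z0} => x y /= [e]; lra.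
Qed.

Lemma sqr_neq1_of_normc_lt1 z : normc z < 1 -> z ^+ 2 != 1.
Proof.
move=> z1; apply/eqP => /(congr1 (@Normc.normc R)); rewrite normcX Normc.normc1 => e.
by have := z1; rewrite -(expr_lt1 (n := 2)) ?normc_ge0// e ltxx.
Qed.

Lemma jost_at_jost V z : summable_potential V -> z != 0 -> normc z <= 1 -> z ^+ 2 != 1 ->
  jost_at V z (jost V z).
Proof.
move=> Vs z0 z1 z2; split; first exact: jost_solution.
apply: cvg0_le (jamp_limit Vs z1); apply: nearW => n.
by rewrite mnorm_ge0/= /jost scalerA -expfzDr// addNr expr0z scale1r lexx.
Qed.

Lemma is_jost_plusP V z u : is_jost_plus V z u <-> jost_at V z u.
Proof.
split=> -[tu lu]; split=> //; last first.
  rewrite /normalized_at_infinity /mcvg in lu.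
  by apply: cvg0_le lu; apply: nearW => n; rewrite hsnorm_ge0/= hsnorm_le_mnorm.
have h : hsnorm ((z ^ (- n%:Z))%R *: u n%:Z - 1%:M) * L%:R ^+ 2 @[n --> \oo] --> 0.
  by apply: cvg0M lu _; exact: cvg_cst.
rewrite /normalized_at_infinity /mcvg; apply: cvg0_le h; apply: nearW => n.
by rewrite mnorm_ge0/= mulrC; exact: mnorm_le_hsnorm.
Qed.

Lemma is_jost_minusP V z u : is_jost_minus V z u <-> jost_at (refl V) z^-1 (refl u).
Proof.
rewrite -is_jost_plusP /is_jost_minus /is_jost_plus invrK [z^-1 + z]addrC.
have E (n : nat) : hsnorm ((z^-1 ^ (- n%:Z))%R *: refl u n%:Z - 1%:M) =
    hsnorm ((z ^ n%:Z)%R *: u (- n%:Z) - 1%:M) by rewrite exprz_inv opprK.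
split=> -[tu lu]; split.
- by apply/funext => n; rewrite tau_refl tu.
- by apply: cvg0_le lu; apply: nearW => n; rewrite hsnorm_ge0 /= E lexx.
- by apply/funext => n; rewrite -[n]opprK -tau_refl tu /refl.
- by apply: cvg0_le lu; apply: nearW => n; rewrite hsnorm_ge0 /= E lexx.
Qed.

Section Unimodular.
Variables (V : int -> M) (z : R[i]).
Hypotheses (V_sa : self_adjoint V) (V_sum : summable_potential V).
Hypotheses (z1 : normc z = 1) (y0 : complex.Im z != 0).

Let z0 : z != 0. Proof. by rewrite -normc_gt0 z1. Qed.
Let z1le : normc z <= 1. Proof. by rewrite z1. Qed.
Let zc1 : normc z^* = 1. Proof. by rewrite normc_conj. Qed.
Let zc1le : normc z^* <= 1. Proof. by rewrite zc1. Qed.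
Let zc0 : z^* != 0. Proof. by rewrite -normc_gt0 zc1. Qed.
Let zcy0 : complex.Im z^* != 0.
Proof. by move: y0; case: (z) => x y /=; rewrite oppr_eq0. Qed.
Let z2 : z ^+ 2 != 1. Proof. exact: unimodular_sqr_neq1. Qed.
Let zc2 : (z^*) ^+ 2 != 1. Proof. exact: unimodular_sqr_neq1. Qed.

Lemma unimodular_inv : z^-1 = z^*.
Proof. by apply: (mulIf z0); rewrite mulVf// unimodular_conj. Qed.

Lemma wronskian_value_neq0 : wronskian_value z != 0.
Proof. by rewrite wronskian_valueE fmorph_eq0 mulf_neq0// pnatr_eq0. Qed.

Lemma jost_plus_unimodular : jost_plus V z = jost V z.
Proof.
have ex : exists u, is_jost_plus V z u.
  by exists (jost V z); apply/is_jost_plusP; exact: jost_at_jost.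
have /is_jost_plusP h := @xgetPex _ 0 [set u | is_jost_plus V z u] ex.
apply: jost_unimodular_unique V_sa z1 wronskian_value_neq0 _ h _.
  by apply: (jost_at_jost (z := z^*)).
exact: jost_at_jost.
Qed.

End Unimodular.

Lemma jost_minus_unimodular V z : self_adjoint V -> summable_potential V ->
  normc z = 1 -> complex.Im z != 0 -> jost_minus V z^-1 = refl (jost (refl V) z).
Proof.
move=> Vsa Vsum z1 y0; have z0 : z != 0 by rewrite -normc_gt0 z1.
have rVsa := self_adjoint_refl Vsa; have rVsum := summable_potential_refl Vsum.
have z1le : normc z <= 1 by rewrite z1.
have zc1 : normc z^* = 1 by rewrite normc_conj.
have zc0 : z^* != 0 by rewrite -normc_gt0 zc1.
have zc1le : normc z^* <= 1 by rewrite zc1.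
have zcy0 : complex.Im z^* != 0 by move: y0; case: (z) => x y /=; rewrite oppr_eq0.
have z2 := unimodular_sqr_neq1 z1 y0; have zc2 := unimodular_sqr_neq1 zc1 zcy0.
have jz := jost_at_jost rVsum z0 z1le z2.
have ex : exists u, is_jost_minus V z^-1 u.
  by exists (refl (jost (refl V) z)); apply/is_jost_minusP; rewrite invrK reflK.
have /is_jost_minusP := @xgetPex _ 0 [set u | is_jost_minus V z^-1 u] ex.
rewrite invrK => h; rewrite -[LHS]reflK; congr refl.
apply: jost_unimodular_unique rVsa z1 (wronskian_value_neq0 y0) _ h jz.
exact: jost_at_jost rVsum zc0 zc1le zc2.
Qed.

End JostIdentification.

Section BoundaryValues.
Context {R : realType} {L : nat} (V : int -> 'M[R[i]]_L).
Hypotheses (V_sa : self_adjoint V) (V_sum : summable_potential V).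
Local Notation M := 'M[R[i]]_L.

Lemma jost_continuous T (F : set_system T) {FF : Filter F} (W : int -> M)
    (zeta : T -> R[i]) z n : summable_potential W ->
  (\forall t \near F, normc (zeta t) <= 1) -> normc z = 1 -> complex.Im z != 0 ->
  ccvg (F := F) zeta z -> mcvg (F := F) (fun t => jost W (zeta t) n) (jost W z n).
Proof.
move=> Wsum zeta1 z1 y0 zF; have z0 : z != 0 by rewrite -normc_gt0 z1.
apply: mcvgZ; first exact: ccvgXz.
by apply: jamp_continuous => //; [rewrite z1|exact: unimodular_sqr_neq1].
Qed.

Lemma wronskian_cvg T (F : set_system T) {FF : Filter F} (u v : T -> int -> M) u0 v0 :
  (forall n, mcvg (F := F) (fun t => u t n) (u0 n)) ->
  (forall n, mcvg (F := F) (fun t => v t n) (v0 n)) ->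
  mcvg (F := F) (fun t => wronskian (u t) (v t)) (wronskian u0 v0).
Proof.
move=> uF vF; apply: mcvgZ; first exact: ccvg_cst.
by apply: mcvgB; apply: mcvgM => //; exact: mcvg_adj.
Qed.

Lemma mcvg_sandwich T (F : set_system T) {FF : Filter F} (c : R[i]) (u x v : T -> M)
    (U X Y : M) :
  mcvg (F := F) u U -> mcvg (F := F) x X -> mcvg (F := F) v Y ->
  mcvg (F := F) (fun t => c *: (u t *m x t *m (v t)^t*)) (c *: (U *m X *m Y^t*)).
Proof.
move=> uU xX vY; apply: mcvgZ; first exact: ccvg_cst.
by apply: mcvgM; [exact: mcvgM|exact: mcvg_adj].
Qed.

Lemma op_cvg_mulmx (T : R -> M -> M) (G : R -> M) (G0 : M) :
  (\forall eps \near 0^'+, forall A, T eps A = G eps *m A) ->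
  mcvg (F := 0^'+) G G0 -> op_cvg T (fun A => G0 *m A).
Proof.
(* The added 1 makes [c] positive for every [L]. *)
move=> TG GG e e0; pose c : R := L%:R ^+ 2 + 1.
have c0 : 0 < c by rewrite ltr_wpDl// exprn_ge0.
have ec : 0 < e / c by rewrite divr_gt0.
have small : \forall eps \near 0^'+, mnorm (G eps - G0) < e / c by exact: cvg0_lt ec GG.
near=> eps => A; have -> : T eps A = G eps *m A by move: A; near: eps.
rewrite -mulmxBl; apply: le_trans (hsnorm_le_mnorm _) _.
apply: le_trans (mnormM _ _) _.
have h1 : mnorm (G eps - G0) <= e / c by apply/ltW; near: eps.
have h2 : mnorm A <= c * hsnorm A.
  apply: le_trans (mnorm_le_hsnorm A) _; apply: ler_wpM2r; first exact: hsnorm_ge0.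
  by rewrite lerDl.
apply: le_trans (ler_pM (mnorm_ge0 _) (mnorm_ge0 _) h1 h2) _.
by rewrite mulrA divfK// gt_eqF.
Unshelve. all: by end_near. Qed.

(** The approach [zeta] and the energy [W] are left abstract so that the upper and the lower
    boundary values are the same statement at [z] and at [1/z]. *)
Lemma limiting_absorption (z : R[i]) (zeta : R -> R[i]) (W : R -> R[i]) r s :
  normc z = 1 -> complex.Im z != 0 ->
  (\forall eps \near 0^'+, [/\ normc (zeta eps) < 1, zeta eps != 0,
     zeta eps + (zeta eps)^-1 = W eps & complex.Im (W eps) != 0]) ->
  ccvg (F := 0^'+) zeta z ->
  let up := jost_plus V in
  let um := jost_minus V in
  (r <= s -> wronskian (um z) (up z) \in unitmx /\
    op_cvg (fun eps => matrix_element (resolvent V_sum (W eps)) s r)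
      (fun A => (- 'i%C) *: (up z s *m invmx (wronskian (um z) (up z)) *m (um z r)^t*) *m A)) /\
  (s < r -> wronskian (up z^-1) (um z^-1) \in unitmx /\
    op_cvg (fun eps => matrix_element (resolvent V_sum (W eps)) s r)
      (fun A => 'i%C *: (um z^-1 s *m invmx (wronskian (up z^-1) (um z^-1)) *m
        (up z^-1 r)^t*) *m A)).
Proof.
move=> z1 y0 zetaW zF up um.
have z0 : z != 0 by rewrite -normc_gt0 z1.
have zc1 : normc z^* = 1 by rewrite normc_conj.
have zcy0 : complex.Im z^* != 0 by move: y0; case: (z) => x y /=; rewrite oppr_eq0.
have rVsa := self_adjoint_refl V_sa; have rVsum := summable_potential_refl V_sum.
have z1le : normc z <= 1 by rewrite z1.
have zc1le : normc z^* <= 1 by rewrite zc1.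
have zc0 : z^* != 0 by rewrite -normc_gt0 zc1.
have z2 := unimodular_sqr_neq1 z1 y0; have zc2 := unimodular_sqr_neq1 zc1 zcy0.
have upz : up z = jost V z by exact: jost_plus_unimodular.
have zV : z^-1 = z^* by exact: unimodular_inv.
have upzV : up z^-1 = jost V z^* by rewrite zV; exact: jost_plus_unimodular.
have umzV : um z^-1 = refl (jost (refl V) z) by exact: jost_minus_unimodular.
have umz : um z = refl (jost (refl V) z^*).
  have := jost_minus_unimodular V_sa V_sum zc1 zcy0.
  by rewrite -zV invrK.
rewrite upz upzV umz umzV.
set a := jost V z; set a' := jost V z^*.
set P := jost (refl V) z; set P' := jost (refl V) z^*.
have ja : jost_at V z a by exact: jost_at_jost.
have ja' : jost_at V z^* a' by exact: jost_at_jost.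
have jP : jost_at (refl V) z P by exact: jost_at_jost.
have jP' : jost_at (refl V) z^* P' by exact: jost_at_jost.
have uA : wronskian (refl P') a \in unitmx by exact: wronskian_unit V_sa z1 y0 ja jP' jP.
have uB : wronskian a' (refl P) \in unitmx.
  rewrite -(wronskian_adj (refl P) a') map_unitmx unitmx_tr.
  have jPcc : jost_at (refl V) (z^*)^* P by rewrite (_ : (z^*)^* = z) //; exact: conjcK.
  exact: wronskian_unit V_sa zc1 zcy0 ja' jPcc jP'.
have zeta1 : \forall eps \near 0^'+, normc (zeta eps) <= 1.
  by apply: filterS zetaW => eps [/ltW].
have zetac1 : \forall eps \near 0^'+, normc (zeta eps)^* <= 1.
  by apply: filterS zeta1 => eps; rewrite normc_conj.
have zcF : ccvg (F := 0^'+) (fun eps => (zeta eps)^*) z^* by exact: ccvg_conj.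
have aF n : mcvg (F := 0^'+) (fun eps => jost V (zeta eps) n) (a n).
  exact: jost_continuous.
have a'F n : mcvg (F := 0^'+) (fun eps => jost V (zeta eps)^* n) (a' n).
  exact: jost_continuous zcF.
have bF n : mcvg (F := 0^'+) (fun eps => refl (jost (refl V) (zeta eps)) n) (refl P n).
  exact: jost_continuous.
have b'F n : mcvg (F := 0^'+) (fun eps => refl (jost (refl V) (zeta eps)^*) n) (refl P' n).
  exact: jost_continuous zcF.
(* Invertibility at the boundary point spreads to small [eps] here, which is what makes the Green
   function formula available off the real axis. *)
have [uAF AF] := mcvg_inv uA (wronskian_cvg b'F aF).
have [uBF BF] := mcvg_inv uB (wronskian_cvg a'F bF).
pose G eps := green (jost V (zeta eps)) (jost V (zeta eps)^*)
  (refl (jost (refl V) (zeta eps))) (refl (jost (refl V) (zeta eps)^*)) r s.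
have GE : \forall eps \near 0^'+, forall A,
    matrix_element (resolvent V_sum (W eps)) s r A = G eps *m A.
  apply: filterS3 zetaW uAF uBF => eps [zl1 zn0 <- yn0] uAe uBe A.
  have zl1le := ltW zl1.
  have zcl1le : normc (zeta eps)^* <= 1 by rewrite normc_conj.
  have zcn0 : (zeta eps)^* != 0 by rewrite -normc_gt0 normc_conj normc_gt0.
  have zn2 := sqr_neq1_of_normc_lt1 zl1.
  have zcn2 : ((zeta eps)^*) ^+ 2 != 1.
    by apply: sqr_neq1_of_normc_lt1; rewrite normc_conj.
  have j1 := jost_at_jost V_sum zn0 zl1le zn2.
  have j2 := jost_at_jost V_sum zcn0 zcl1le zcn2.
  have j3 := jost_at_jost rVsum zn0 zl1le zn2.
  have j4 := jost_at_jost rVsum zcn0 zcl1le zcn2.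
  exact: (matrix_element_green V_sa V_sum zn0 zl1le j1 j2 j3 j4 uAe uBe).
have greenP : r <= s -> G = fun eps => (- 'i%C) *: (jost V (zeta eps) s *m
   invmx (wronskian (refl (jost (refl V) (zeta eps)^*)) (jost V (zeta eps))) *m
   (refl (jost (refl V) (zeta eps)^*) r)^t*).
  by move=> rs; apply/funext => eps; rewrite /G /green rs.
have greenN : s < r -> G = fun eps => 'i%C *: (refl (jost (refl V) (zeta eps)) s *m
   invmx (wronskian (jost V (zeta eps)^*) (refl (jost (refl V) (zeta eps)))) *m
   (jost V (zeta eps)^* r)^t*).
  by move=> sr; apply/funext => eps; rewrite /G /green leNgt sr.
split=> rs; split=> //; apply: op_cvg_mulmx GE _.
  by rewrite greenP//; exact: mcvg_sandwich (aF s) AF (b'F r).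
by rewrite greenN//; exact: mcvg_sandwich (bF s) BF (a'F r).
Qed.

End BoundaryValues.

(** * The roots of [zeta + 1/zeta = w] in the unit disk *)

Section SpectralParameter.
Context {R : realType}.
Implicit Types (z w zeta : R[i]).

Lemma joukowski_root w : complex.Im w != 0 -> exists zeta,
  [/\ normc zeta < 1, zeta != 0 & zeta + zeta^-1 = w].
Proof.
move=> w0; pose s := sqrtC (w ^+ 2 - 4); have sE : s ^+ 2 = w ^+ 2 - 4 by exact: sqrtCK.
pose x := (w + s) / 2; pose y := (w - s) / 2.
have xy : x * y = 1.
  have -> : x * y = (w ^+ 2 - s ^+ 2) / 4 by rewrite /x /y; field.
  by rewrite sE; field.
have xyw : x + y = w by rewrite /x /y; field.
have nxy : normc x * normc y = 1 by rewrite -Normc.normcM xy Normc.normc1.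
have x0 : x != 0 by apply: contra_eq_neq xy => ->; rewrite mul0r eq_sym oner_neq0.
have y0 : y != 0 by apply: contra_eq_neq xy => ->; rewrite mulr0 eq_sym oner_neq0.
have xV : x^-1 = y by apply: (mulfI x0); rewrite mulfV.
have [x1|x1] := ltP (normc x) 1; first by exists x; split=> //; rewrite xV.
have [y1|y1] := ltP (normc y) 1.
  by exists y; split=> //; rewrite -xV invrK addrC xV.
(* The two roots have product 1; if neither is inside the disk both are on the circle, hence
   conjugate, and their sum [w] is real. *)
have nx1 : normc x = 1.
  apply/eqP; rewrite eq_le x1 andbT -nxy ler_peMr ?normc_ge0//.
have := unimodular_inv nx1; rewrite xV => yE.
by move: w0; rewrite -xyw yE; case: (x) => p q /=; rewrite subrr eqxx.
Qed.

(** The imaginary part of [zeta + 1/zeta] is [Im zeta] times [1 - |zeta|^-2], which is negative in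
    the disk. So energies above the axis select the root that tends to [z = e^(-ik)]. *)
Lemma joukowski_Im_lt0 zeta : normc zeta < 1 -> zeta != 0 ->
  0 < complex.Im (zeta + zeta^-1) -> complex.Im zeta < 0.
Proof.
move=> z1 z0; have n0 : 0 < normc zeta by rewrite normc_gt0.
have n2 : 0 < normc zeta ^+ 2 by rewrite exprn_gt0.
have n1 : normc zeta ^+ 2 < 1 by rewrite expr_lt1 ?normc_ge0.
have := sqr_normcE zeta; move: n2 n1; move: (normc zeta ^+ 2) => m m0 m1.
case: zeta z0 z1 n0 => x y z0 z1 n0 /= mE; rewrite -mE => h.
have V1 : 1 < m^-1 by rewrite invf_gt1.
have {}h : 0 < y * (1 - m^-1) by rewrite mulrBr mulr1.
rewrite ltNge; apply/negP => y0; move: h; apply/negP; rewrite -leNgt.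
by rewrite mulr_ge0_le0// subr_le0 ltW.
Qed.

(** The product of the distances from [zeta] to the two roots [z], [1/z] at energy [E] is
    [|zeta| eps], and [1/z] is far away, being in the upper half plane while [zeta] is in the lower
    one. *)
Lemma joukowski_root_dist z zeta (E eps : R) : normc z = 1 -> complex.Im z < 0 ->
  z + z^-1 = E%:C -> 0 < eps -> normc zeta < 1 -> zeta != 0 -> zeta + zeta^-1 = E +i* eps ->
  normc (zeta - z) <= eps / - complex.Im z.
Proof.
move=> z1 y0 zE e0 n1 zeta0 zetaE; have z0 : z != 0 by rewrite -normc_gt0 z1.
have y0' : 0 < - complex.Im z by rewrite oppr_gt0.
have prod : (zeta - z) * (zeta - z^-1) = zeta * (0 +i* eps).
  have -> : 0 +i* eps = (zeta + zeta^-1) - (z + z^-1).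
    by rewrite zetaE zE; apply/eqP; rewrite eq_complex /= subrr subr0 !eqxx.
  by field; rewrite zeta0 z0.
have Im0 : complex.Im zeta < 0 by apply: joukowski_Im_lt0; rewrite ?zetaE.
have far : - complex.Im z <= normc (zeta - z^-1).
  rewrite (unimodular_inv z1); apply: le_trans (normc_Im_le _).
  move: Im0; case: (zeta) (z) => [p q] [x y] /= q0.
  by rewrite ler_normr; apply/orP; right; rewrite opprD opprK; lra.
rewrite ler_pdivlMr//; apply: le_trans (ler_wpM2l (normc_ge0 _) far) _.
rewrite -Normc.normcM prod Normc.normcM.
have -> : normc (0 +i* eps : R[i]) = eps.
  by rewrite /= expr0n add0r sqrtr_sqr gtr0_norm.
by apply: ler_piMl; apply: ltW.
Qed.

Lemma joukowski_branch z (E : R) : normc z = 1 -> complex.Im z < 0 -> z + z^-1 = E%:C ->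
  exists zeta : R -> R[i], (forall eps, 0 < eps -> [/\ normc (zeta eps) < 1, zeta eps != 0 &
     zeta eps + (zeta eps)^-1 = E +i* eps]) /\ ccvg (F := 0^'+) zeta z.
Proof.
move=> z1 y0 zE.
have ex (eps : R) : exists x : R[i], 0 < eps ->
    [/\ normc x < 1, x != 0 & x + x^-1 = E +i* eps].
  have [e0|e0] := ltP 0 eps; last by exists 0.
  have [x hx] := @joukowski_root (E +i* eps) (lt0r_neq0 e0).
  by exists x.
have [zeta zetaP] := choice ex; exists zeta; split=> //.
have h : eps * (- complex.Im z)^-1 @[eps --> 0^'+] --> 0.
  apply: cvg0M; last exact: cvg_cst.
  by apply: cvg_at_right_filter; exact: cvg_id.
apply: cvg0_le h; near=> eps; have e0 : 0 < eps by [].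
have [n1 n0 e] := zetaP _ e0.
by rewrite normc_ge0 /= (joukowski_root_dist z1 y0 zE e0).
Unshelve. all: by end_near. Qed.

End SpectralParameter.

Unset Implicit Arguments.

Theorem theorem1p6 (R : realType) (L : nat) (L_ge1 : (1 <= L)%N)
    (V : int -> 'M[R[i]]_L) (V_sa : self_adjoint V)
    (V_sum : summable_potential V)
    (E k : R) (E_itv : -2 < E < 2) (k_itv : 0 < k < pi) (Ek : E = 2 * cos k) :
  let z : R[i] := expi (- k) in
  let up := jost_plus V in
  let um := jost_minus V in
  let RH := resolvent V_sum in
  forall r s : int,
  (r <= s ->
    [/\ wronskian (um z) (up z) \in unitmx,
        op_cvg (fun eps : R => matrix_element (RH (E +i* eps)) s r)
          (fun A => (- 'i%C) *: (up z s *m invmx (wronskian (um z) (up z))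
                               *m (um z r)^t*) *m A),
        wronskian (um z^-1) (up z^-1) \in unitmx &
        op_cvg (fun eps : R => matrix_element (RH (E -i* eps)) s r)
          (fun A => (- 'i%C) *: (up z^-1 s *m invmx (wronskian (um z^-1) (up z^-1))
                               *m (um z^-1 r)^t*) *m A)]) /\
  (s < r ->
    [/\ wronskian (up z^-1) (um z^-1) \in unitmx,
        op_cvg (fun eps : R => matrix_element (RH (E +i* eps)) s r)
          (fun A => 'i%C *: (um z^-1 s *m invmx (wronskian (up z^-1) (um z^-1))
                           *m (up z^-1 r)^t*) *m A),
        wronskian (up z) (um z) \in unitmx &
        op_cvg (fun eps : R => matrix_element (RH (E -i* eps)) s r)
          (fun A => 'i%C *: (um z s *m invmx (wronskian (up z) (um z))
                           *m (up z r)^t*) *m A)]).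
Proof.
move=> z up um RH r s.
have sk : 0 < sin k by exact: sin_gt0_pi.
have z1 : normc z = 1.
  by rewrite /z /expi /= cosN sinN sqrrN cos2Dsin2 sqrtr1.
have Imz : complex.Im z = - sin k by rewrite /z /expi /= sinN.
have Imz0 : complex.Im z < 0 by rewrite Imz oppr_lt0.
have zV : z^-1 = z^* by exact: unimodular_inv.
have zE : z + z^-1 = E%:C.
  rewrite zV Ek /z /expi cosN sinN; apply/eqP; rewrite eq_complex /=.
  by apply/andP; split; apply/eqP; ring.
have [zeta [zetaP zetaz]] := joukowski_branch z1 Imz0 zE.
have y0 : complex.Im z != 0 by rewrite lt_eqF.
have plusP : \forall eps \near 0^'+, [/\ normc (zeta eps) < 1, zeta eps != 0,
    zeta eps + (zeta eps)^-1 = E +i* eps & complex.Im (E +i* eps) != 0].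
  near=> eps; have e0 : 0 < eps by [].
  by have [? ? ?] := zetaP _ e0; split=> //=; rewrite gt_eqF.
have zc1 : normc z^-1 = 1 by rewrite zV normc_conj.
have yc0 : complex.Im z^-1 != 0.
  by rewrite zV; move: y0; case: (z) => p q /=; rewrite oppr_eq0.
(* The conjugate root belongs to the conjugate energy [E - i eps] and tends to [conj z = 1/z], which
   interchanges the roles of [z] and [1/z]. *)
have minusP : \forall eps \near 0^'+, [/\ normc (zeta eps)^* < 1, (zeta eps)^* != 0,
    (zeta eps)^* + ((zeta eps)^*)^-1 = E -i* eps & complex.Im (E -i* eps) != 0].
  near=> eps; have e0 : 0 < eps by [].
  have [h1 h2 h3] := zetaP _ e0; split=> /=.
  - by rewrite normc_conj.
  - by rewrite -normc_gt0 normc_conj normc_gt0.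
  - have -> : E -i* eps = (E +i* eps)^* by [].
    by rewrite -h3 rmorphD; congr (_ + _); exact/esym/conjc_inv.
  - by rewrite oppr_eq0 gt_eqF.
have zetac : ccvg (F := 0^'+) (fun eps => (zeta eps)^*) z^-1.
  by rewrite zV; exact: ccvg_conj.
have [plus_ge plus_lt] := limiting_absorption V_sa V_sum r s z1 y0 plusP zetaz.
have [minus_ge minus_lt] := limiting_absorption V_sa V_sum r s zc1 yc0 minusP zetac.
rewrite invrK in minus_lt.
split=> rs.
  have [h1 h2] := plus_ge rs; have [h3 h4] := minus_ge rs.
  exact: And4 h1 h2 h3 h4.
have [h1 h2] := plus_lt rs; have [h3 h4] := minus_lt rs.
exact: And4 h1 h2 h3 h4.
Unshelve. all: by end_near. Qed.
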